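(* Let $p\geq 2$ be an integer, $r=\lceil\log_2(p-1)\rceil$ and $N_r=\binom{\lceil r/2\rceil+1}{2}+\binom{\lfloor r/2\rfloor+1}{2}$. For all integers $m\geq 2N_r+2$ and $0\leq q\leq p-1$, $$\mathrm{forb}(m,3,F(p-q,p,p,p-q))=\mathrm{forb}(m,3,p\cdot K_2)-qN_r$$ if one of the following holds: (i) $p\geq 2^{r-1}+2q+1$; (ii) $p\leq 2^{r-1}+2q$, $qN_r\leq 2^{r-3}$ and $\frac12(\lfloor r/2\rfloor+1)(p-1-2^{r-1})\geq q$. In particular, for every fixed integer $q\geq 0$ this equality holds for all sufficiently large $p$ (and all $m\geq 2N_r+2$).
   Context: An $s$-matrix is a matrix with entries in $\{0,\dots,s-1\}$; simple means no repeated columns; $|A|$ is the number of columns. $F\prec A$ means some submatrix of $A$ is a row/column permutation of $F$. $\mathrm{Avoid}(m,s,F)$ is the set of $m$-rowed simple $s$-matrices avoiding $F$ as a configuration, and $\mathrm{forb}(m,s,F)$ the maximum number of columns of a member of $\mathrm{Avoid}(m,s,F)$. For nonnegative integers $a,b,c,d$, $F(a,b,c,d)$ is the 2-rowed $(0,1)$-matrix consisting of $a$ columns $\binom{0}{0}$, $b$ columns $\binom{1}{0}$, $c$ columns $\binom{0}{1}$ and $d$ columns $\binom{1}{1}$ (top entry first). $K_2$ is the $2\times4$ matrix of all $(0,1)$-columns of length 2 and $p\cdot K_2$ is the concatenation of $p$ copies of it. *)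

(* Defs.v *)
From HB Require Import structures.
From mathcomp Require Import all_boot all_order all_algebra.
Set Implicit Arguments. Unset Strict Implicit. Unset Printing Implicit Defensive.

(* A column of an m-rowed s-matrix: a function 'I_m -> 'I_s (entries 0..s-1).
   A simple m-rowed s-matrix (no repeated columns) is a finite set of columns;
   its number of columns |A| is #|A|. *)
Definition column (m s : nat) := {ffun 'I_m -> 'I_s}.
Definition simple_matrix (m s : nat) := {set column m s}.

(* F (a k x l matrix with nat entries, possibly repeated columns) is a
   configuration of A (F \prec A): some submatrix of A (rows rho, distinct
   columns sigma) is a row/column permutation of F. *)
Definition configb (k l m s : nat) (F : 'M[nat]_(k, l)) (A : simple_matrix m s)
  : bool :=
  [exists rho : {ffun 'I_k -> 'I_m},
   [exists sigma : {ffun 'I_l -> column m s},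
     [&& injectiveb rho, injectiveb sigma,
         [forall c, sigma c \in A] &
         [forall r, forall c, F r c == nat_of_ord (sigma c (rho r))]]]].

Definition forb (m s k l : nat) (F : 'M[nat]_(k, l)) : nat :=
  \max_(A : simple_matrix m s | ~~ configb F A) #|A|.

(* F(a,b,c,d): a columns (0,0), b columns (1,0), c columns (0,1), d columns
   (1,1), top entry (row 0) first. *)
Definition Fabcd (a b c d : nat) : 'M[nat]_(2, a + b + c + d) :=
  \matrix_(i < 2, j < a + b + c + d)
    (let top := if j < a then 0 else if j < a + b then 1
                else if j < a + b + c then 0 else 1 in
     let bot := if j < a + b then 0 else 1 in
     if i == 0 :> nat then top else bot).

(* K_2 with columns (0,0),(1,0),(0,1),(1,1); p.K_2 is p copies concatenated:
   column j of p.K_2 is column (j mod 4) of K_2. *)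
Definition pK2 (p : nat) : 'M[nat]_(2, 4 * p) :=
  \matrix_(i < 2, j < 4 * p)
    (let t := j %% 4 in
     if i == 0 :> nat then (if (t == 1) || (t == 3) then 1 else 0)
     else (if t >= 2 then 1 else 0)).

Definition rr (p : nat) : nat := up_log 2 (p - 1).

Definition Nr (r : nat) : nat := 'C(uphalf r + 1, 2) + 'C(r./2 + 1, 2).

(* Main.v *)
Require Import Defs.
From mathcomp Require Import all_boot all_order all_algebra.
From mathcomp Require Import zify ring lra.
Set Implicit Arguments. Unset Strict Implicit. Unset Printing Implicit Defensive.

(** Since p.K_2 and F(p,p,p,p) have the same columns, both sides come from one formula for
    forb(m,3,F(p-q,p,p,p-q)).  A matrix A avoids F(p-q,p,p,p-q) iff each pair {e,f} of rows has a
    (0,1)-pattern (a e f, a f e) that occurs in at most p-1 columns (at most p-1-q if it is 00 or 11).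
    Columns without any such pattern number at most |S|+1 for each set S of non-2 positions; every other
    column uses up budget of at least one pair.  The bound [base + (p-1) * C(m,2)] is therefore lost only
    through a deficit on some S, columns violating several pairs, unfilled budgets, or the pairs with
    pattern 00 or 11, which cost q each.

    If the patterns of some triple of rows conflict, the deficits add up to 2^(m-3), too much.  Otherwise
    the patterns come from an oriented tree whose edges are the rows: "e precedes f" is a strict order with
    linear intervals, the incomparable pairs are those with pattern 00 or 11, and the columns violating only
    the pair {e,f} number exactly 2^k, k counting the other rows not between e and f.  So a pair with at least
    m-1-r rows in between loses at least (p-1-2^(r-1))/2.  The order has at least N_r incomparable or far
    pairs: some row g is in no such pair, and deleting a suitable minimal or maximal row destroys
    ceil(r/2) = N_r - N_(r-1) of them.  When a far pair costs less than q, one counts instead the depths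
    below and above g.  Equality holds for a broom: a path with ceil(r/2)+1 minimal and floor(r/2)+1
    maximal rows. *)

(** * Configurations as pattern counts *)

Definition sym (b : bool) : 'I_3 := inord b.
Definition two : 'I_3 := inord 2.

Lemma val_sym b : sym b = b :> nat. Proof. by rewrite inordK //; case: b. Qed.
Lemma val_two : two = 2 :> nat. Proof. by rewrite inordK. Qed.
Lemma sym_inj : injective sym.
Proof. by move=> b c /(congr1 (@nat_of_ord _)); rewrite !val_sym; case: b c => [] []. Qed.
Lemma sym_two b : (sym b == two) = false.
Proof. by apply/eqP => /(congr1 (@nat_of_ord _)); rewrite val_sym val_two; case: b. Qed.
Lemma ord3P (u : 'I_3) : u = two \/ exists b, u = sym b.
Proof.
case: u => [[|[|[|//]]] h]; [right; exists false|right; exists true|left];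
  by apply: val_inj; rewrite /= ?val_sym ?val_two.
Qed.

(** Number the elements of each fibre of [k] and send them to the equally numbered elements of the
    matching fibre of [t] in [A]; images of different fibres are separated by [t]. *)
Lemma fiber_injection (C X K : finType) (x0 : X) (A : {set X}) (k : C -> K) (t : X -> K) :
    (forall u, #|[set c | k c == u]| <= #|[set x in A | t x == u]|) ->
  exists2 s : C -> X, injective s & forall c, s c \in A /\ t (s c) = k c.
Proof.
move=> le_kt.
pose ix c := index c (enum [set d | k d == k c]).
pose s c := nth x0 (enum [set x in A | t x == k c]) (ix c).
have ltix c : ix c < size (enum [set x in A | t x == k c]).
  rewrite -cardE; apply: leq_trans (le_kt (k c)).
  by rewrite [leqRHS]cardE index_mem mem_enum inE.
have sP c : s c \in A /\ t (s c) = k c.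
  have := mem_nth x0 (ltix c); rewrite mem_enum inE => /andP[hA /eqP ht]; by split.
exists s => // c d eq_s.
have eq_k : k c = k d by rewrite -(sP c).2 -(sP d).2 eq_s.
have := ltix d; have := ltix c; move: eq_s; rewrite /s /ix eq_k => eq_s lc ld.
move/eqP: eq_s; rewrite nth_uniq ?enum_uniq // => /eqP e.
by rewrite -(@nth_index _ c c (enum [set e | k e == k d])) ?e ?nth_index // mem_enum inE ?eq_k.
Qed.

Section Patterns.
Variable m : nat.
Implicit Types (A : simple_matrix m 3) (i j : 'I_m).

Definition pats A i j u v := [set x in A | (x i == sym u) && (x j == sym v)].

Lemma patsC A i j u v : pats A i j u v = pats A j i v u.
Proof. by apply/setP => x; rewrite !inE [(x i == _) && _]andbC. Qed.

Lemma configbP l (F : 'M[nat]_(2, l)) (n : bool -> bool -> nat) A :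
    (forall c r, F r c < 2) ->
    (forall u v : bool, #|[set c | (F ord0 c == u :> nat) && (F ord_max c == v :> nat)]| = n u v) ->
  reflect (exists i j, i != j /\ forall u v, n u v <= #|pats A i j u v|) (configb F A).
Proof.
move=> F2 nF; apply: (iffP existsP) => [[rho /existsP[sg /and4P[/injectiveP rI /injectiveP sI]]]|].
  move=> /forallP sA /forallP sF.
  exists (rho ord0), (rho ord_max); split=> [|u v]; first by apply/eqP => /rI.
  rewrite -nF -(card_imset _ sI); apply/subset_leq_card/subsetP => x /imsetP[c].
  rewrite !inE => /andP[/eqP h0 /eqP h1] ->; rewrite sA /=.
  move: (sF ord0) (sF ord_max) => /forallP/(_ c)/eqP e0 /forallP/(_ c)/eqP e1.
  by apply/andP; split; apply/eqP/val_inj; rewrite /= -?e0 -?e1 val_sym.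
move=> [i [j [ij le_n]]].
have tb k : k < 2 -> k = (k == 1) :> nat by case: k => [|[|]].
pose k c := (F ord0 c == 1, F ord_max c == 1).
(* Without an entry 2 in rows [i] and [j], the Boolean pair [t] determines both entries. *)
pose A' := A :&: [set x : column m 3 | [&& x i != two & x j != two]].
pose t (x : column m 3) := (x i == sym true, x j == sym true).
have [|s sI sP] := @fiber_injection _ (column m 3) _ [ffun => two] A' k t.
  move=> [u v]; apply: (@leq_trans (n u v)).
    rewrite -nF; apply/subset_leq_card/subsetP => c; rewrite !inE /k xpair_eqE.
    by move=> /andP[/eqP <- /eqP <-]; rewrite -!tb ?F2 ?eqxx.
  apply: leq_trans (le_n u v) _; apply/subset_leq_card/subsetP => x; rewrite !inE /t.
  move=> /and3P[-> /eqP -> /eqP ->]; rewrite !sym_two /= xpair_eqE.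
  by rewrite !(inj_eq sym_inj) !eqb_id !eqxx.
exists [ffun r => if r == ord0 then i else j]; apply/existsP.
exists [ffun c => s c].
apply/and4P; split.
- apply/injectiveP => r r'; rewrite !ffunE.
  case: (r =P ord0) => [->|/eqP r0]; case: (r' =P ord0) => [->|/eqP r'0] // e.
  + by rewrite e eqxx in ij.
  + by rewrite e eqxx in ij.
  + move: r0 r'0 => {e}; case: r => [[|[|//]] hr]; case: r' => [[|[|//]] hr'] // _ _.
    exact: val_inj.
- by apply/injectiveP => c c'; rewrite !ffunE; apply: sI.
- by apply/forallP => c; rewrite !ffunE; case: (sP c); rewrite inE => /andP[].
apply/forallP => r; apply/forallP => c; rewrite !ffunE.
case: (sP c); rewrite !inE => /and3P[_ x2 y2] [e0 e1].
case: (r =P ord0) => [->|/eqP r0].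
  rewrite (tb (F ord0 c)) ?F2 // -e0; apply/eqP.
  by case: (ord3P (s c i)) x2 => [->|[b ->]]; rewrite ?eqxx // val_sym (inj_eq sym_inj) eqb_id.
have -> : r = ord_max by apply/val_inj; case: r r0 => [[|[|//]] hr].
rewrite (tb (F ord_max c)) ?F2 // -e1; apply/eqP.
by case: (ord3P (s c j)) y2 => [->|[b ->]]; rewrite ?eqxx // val_sym (inj_eq sym_inj) eqb_id.
Qed.

Lemma card_ord_pred n (P : pred nat) : #|[set c : 'I_n | P c]| = count P (iota 0 n).
Proof. by rewrite cardsE cardE size_filter -(val_enum_ord n) count_map enumT. Qed.

Definition cnt4 (a b c d : nat) (u v : bool) := if v then (if u then d else c) else (if u then b else a).

Lemma Fabcd_configP a b c d A :
  reflect (exists i j, i != j /\ forall u v, cnt4 a b c d u v <= #|pats A i j u v|)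
          (configb (Fabcd a b c d) A).
Proof.
apply: configbP => [k r|u v].
  by rewrite mxE /=; repeat case: ifP => _ //.
pose P k := ((if k < a then 0 else if k < a + b then 1 else if k < a + b + c then 0 else 1)
  == u :> nat) && ((if k < a + b then 0 else 1) == v :> nat).
have -> : [set k | (Fabcd a b c d ord0 k == u) && (Fabcd a b c d ord_max k == v)]
   = [set k : 'I_(a + b + c + d) | P k] by apply/setP => k; rewrite !inE !mxE.
rewrite card_ord_pred !iotaD !count_cat.
have cst lo n w : (forall k, lo <= k < lo + n -> P k = w) -> count P (iota lo n) = n * w.
  move=> h; rewrite (@eq_in_count _ _ (fun=> w)); last by move=> k; rewrite mem_iota => /h.
  by case: w {h}; rewrite ?count_predT ?size_iota ?muln1 // count_pred0 muln0.
rewrite (cst _ _ (~~ u && ~~ v)) => [|k hk]; last first.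
  rewrite /P; have -> : k < a by lia. have -> : k < a + b by lia. by case: u v {P cst} => [] [].
rewrite (cst _ _ (u && ~~ v)) => [|k hk]; last first.
  rewrite /P; have -> : k < a = false by lia. have -> : k < a + b by lia. by case: u v {P cst} => [] [].
rewrite (cst _ _ (~~ u && v)) => [|k hk]; last first.
  rewrite /P; have -> : k < a = false by lia. have -> : k < a + b = false by lia.
  have -> : k < a + b + c by lia. by case: u v {P cst} => [] [].
rewrite (cst _ _ (u && v)) => [|k hk]; last first.
  rewrite /P; have -> : k < a = false by lia. have -> : k < a + b = false by lia.
  have -> : k < a + b + c = false by lia. by case: u v {P cst} => [] [].
by case: u v {P cst} => [] []; rewrite /cnt4 /=; lia.
Qed.

Lemma pK2_configP p A :
  reflect (exists i j, i != j /\ forall u v, p <= #|pats A i j u v|) (configb (pK2 p) A).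
Proof.
apply: (@configbP _ _ (fun _ _ => p)) => [k r|u v].
  by rewrite mxE /=; repeat case: ifP => _ //.
pose P k := ((if (k %% 4 == 1) || (k %% 4 == 3) then 1 else 0) == u :> nat)
  && ((if k %% 4 >= 2 then 1 else 0) == v :> nat).
have -> : [set k | (pK2 p ord0 k == u) && (pK2 p ord_max k == v)]
   = [set k : 'I_(4 * p) | P k] by apply/setP => k; rewrite !inE !mxE.
rewrite card_ord_pred; elim: p => [|p IH] //.
rewrite (_ : 4 * p.+1 = 4 * p + 4); last by lia.
rewrite iotaD count_cat IH add0n -[RHS]addn1; congr (_ + _).
have e (k i : nat) : i < 4 -> 4 * p + i = k -> k %% 4 = i.
  by move=> hi <-; rewrite mulnC modnMDl modn_small.
rewrite /= /P (e (4 * p) 0) ?addn0 // (e (4 * p).+1 1) ?addn1 //.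
rewrite (e (4 * p).+2 2) ?addn2 // (e (4 * p).+3 3) ?addn3 //.
by case: u v {P IH e} => [] [].
Qed.

End Patterns.

Lemma forb_pK2 m p : forb m 3 (pK2 p) = forb m 3 (Fabcd p p p p).
Proof.
apply: eq_bigl => A; congr (~~ _); apply/pK2_configP/Fabcd_configP => -[i [j [ij h]]];
  exists i, j; split=> // u v; by have := h u v; case: u v => [] [].
Qed.

(** * The numbers N_r *)

(** Passing to [r.+1] exchanges the two halves and raises only [r./2] by one. *)
Lemma NrS r : Nr r.+1 = Nr r + uphalf r.+1.
Proof. by rewrite /Nr !addn1 /= [in LHS]binS bin1 addnAC ['C(r./2.+1, 2) + _]addnC. Qed.

Lemma double_bin2 n : 2 * 'C(n.+1, 2) = n * n.+1.
Proof. by have := mul_bin_diag n.+1 1; rewrite bin1 mulnC => <-. Qed.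

Lemma double_Nr r : 2 * Nr r = uphalf r * (uphalf r).+1 + r./2 * (r./2).+1.
Proof. by rewrite /Nr !addn1 mulnDr !double_bin2. Qed.

Section SplitWeightInt.
Import GRing.Theory Num.Theory Order.TTheory.

(** Write [B = L + s] and [A = c - s]. The difference of the sides contains
    [2 (L - 1) s (s + L - c)], quadratic in the integer [s]; it dominates the negative linear
    contributions, whose coefficient is at most [2 (L - 1)]. For [c = uphalf r] and [L = r./2.+1]
    the constant [c (c + 1) + (L - 1) L] is [2 * Nr r]. *)
Lemma split_weight_int (L c A B al be : int) : (0 <= L - c <= 1 -> 0 <= al < A -> 0 <= be < B ->
  A + B = c + L ->
  L * (c * (c + 1) + (L - 1) * L + A + B)
    <= L * (A * A + 2 * al + (B * B + 2 * be)) + 2 * ((A - al) * (B - be)))%R.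
Proof.
move=> /andP[h0 h1] /andP[a0 a1] /andP[b0 b1] e.
pose s := (B - L)%R; pose de := (L - c)%R.
have eB : (B = L + s)%R by rewrite /s; lia.
have eA : (A = L - de - s)%R by rewrite /s /de; lia.
have ec : (c = L - de)%R by rewrite /de; lia.
rewrite -subr_ge0.
have -> : (L * (A * A + 2 * al + (B * B + 2 * be)) + 2 * ((A - al) * (B - be)) -
  L * (c * (c + 1) + (L - 1) * L + A + B) =
  2 * ((L - 1) * (s * (de + s)) - al * s + be * (de + s) + al * be))%R.
  by rewrite eA eB ec; ring.
have hab : (0 <= al * be)%R by nia.
have [hs|hs] := lerP 0 s.
  have h3 : (al * s <= (L - 1) * s)%R by nia.
  have h4 : ((L - 1) * s <= (L - 1) * (s * (de + s)))%R.
    have h5 : (s <= s * (de + s))%R by nia.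
    by apply: ler_wpM2l => //; lia.
  have h6 : (0 <= be * (de + s))%R by nia.
  lia.
have hd : (0 <= - (de + s))%R by rewrite /de; lia.
have h3 : (be * - (de + s) <= (L - 1) * - (de + s))%R by apply: ler_wpM2r => //; lia.
have h4 : ((L - 1) * - (de + s) <= (L - 1) * (s * (de + s)))%R.
  by apply: ler_wpM2l; nia.
have h5 : (al * s <= 0)%R by nia.
lia.
Qed.

End SplitWeightInt.

(** [A] and [B] stand for the sizes of the sets below and above an element, minus their greatest
    depths, and [a], [b] for the numbers of deepest elements: the far pairs among the latter,
    weighted by [1 / L], make up for missing incomparable pairs. *)
Lemma split_weight_ge r L A B a b : L = r./2.+1 -> 0 < a <= A -> 0 < b <= B -> A + B = r.+1 ->
  L * (2 * Nr r + A + B) <= L * (A * A + 2 * (A - a) + (B * B + 2 * (B - b))) + 2 * (a * b).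
Proof.
move=> eL ha hb hAB; rewrite double_Nr.
have hr := odd_double_half r; have hu := uphalf_half r.
have e2 : r./2 = L.-1 by rewrite eL.
have hc : (0 <= L%:Z - (uphalf r)%:Z <= 1)%R by rewrite eL hu; case: (odd r); lia.
have hAL : (0 <= (A - a)%N%:Z < A%:Z)%R by lia.
have hBL : (0 <= (B - b)%N%:Z < B%:Z)%R by lia.
have hs : (A%:Z + B%:Z = (uphalf r)%:Z + L%:Z)%R by rewrite eL; lia.
have := split_weight_int hc hAL hBL hs.
have -> : ((A%:Z - (A - a)%N%:Z) = a%:Z)%R by lia.
have -> : ((B%:Z - (B - b)%N%:Z) = b%:Z)%R by lia.
have -> : (L%:Z - 1 = L.-1%:Z)%R by lia.
rewrite e2 (_ : L.-1.+1 = L) //; last by lia.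
by move=> h; lia.
Qed.

(** Equality holds for the balanced split [uphalf r + 1], [r./2 + 1]; [A (A - 1) + B (B - 1)] does
    not drop when the sum grows or the split becomes more uneven. *)
Lemma split_ge r A B : 0 < A -> 0 < B -> r.+2 <= A + B -> 2 * Nr r + A + B <= A * A + B * B.
Proof.
move=> hA hB hAB; rewrite double_Nr.
have hr := odd_double_half r; have hu := uphalf_half r.
move: (uphalf r) (r./2) hr hu => u v hr hu.
have : u = v \/ u = v.+1 by case: (odd r) hu; lia.
case: A B hA hB hAB => // A [//|B] _ _ hAB huv.
wlog AB : A B hAB / A <= B.
  move=> H; case: (leqP A B) => [|/ltnW] h; first exact: H.
  by have := H B A; rewrite addnC => /(_ hAB h); lia.
have [vA|Av] := leqP v A.
  have uB : u <= B by lia.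
  nia.
have [j eA] : exists j, v = A + j by exists (v - A); lia.
have uB : u + j <= B by lia.
have : (u + j) * (u + j) <= B * B by apply: leq_mul.
nia.
Qed.

(** * Orders with linear intervals *)

Section Poset.
Variable T : finType.
Implicit Types (lt : rel T) (X : {set T}).

Definition interval_chain lt := [/\ irreflexive lt, transitive lt &
  forall x y y' z, lt x y -> lt y z -> lt x y' -> lt y' z -> y != y' -> lt y y' || lt y' y].

Definition opp_rel lt : rel T := fun x y => lt y x.
Definition inc lt x y := [&& x != y, ~~ lt x y & ~~ lt y x].
Definition btw lt X x y := #|[set u in X | lt x u && lt u y]|.
(** In use [|X| = t + r + 1], so at most [r - 1] further elements are not in between. *)
Definition far lt X t x y := lt x y && (t <= btw lt X x y).
Definition bad lt X t x y := [|| inc lt x y, far lt X t x y | far lt X t y x].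

Lemma interval_chain_opp lt : interval_chain lt -> interval_chain (opp_rel lt).
Proof.
case=> ir tr ch; split; first exact: ir.
  by move=> y x z h1 h2; apply: tr h2 h1.
by move=> x y y' z h1 h2 h3 h4 h5; rewrite /opp_rel orbC; apply: (ch z y y' x).
Qed.

Lemma btw_opp lt X x y : btw (opp_rel lt) X x y = btw lt X y x.
Proof. by apply: eq_card => u; rewrite !inE /opp_rel [X in _ && X]andbC. Qed.

Lemma inc_opp lt x y : inc (opp_rel lt) x y = inc lt x y.
Proof. by rewrite /inc [X in _ && X]andbC. Qed.

Lemma bad_opp lt X t x y : bad (opp_rel lt) X t x y = bad lt X t x y.
Proof. by rewrite /bad (inc_opp lt) /far (btw_opp lt X x y) (btw_opp lt X y x) [X in _ || X]orbC. Qed.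

Lemma incC lt x y : inc lt x y = inc lt y x.
Proof. by rewrite /inc eq_sym [X in _ && X]andbC. Qed.

Lemma badC lt X t x y : bad lt X t x y = bad lt X t y x.
Proof. by rewrite /bad incC [X in _ || X]orbC. Qed.

Lemma bad_irr lt X t x : irreflexive lt -> bad lt X t x x = false.
Proof. by move=> ir; rewrite /bad /inc /far eqxx ir. Qed.

Lemma injective_ge (K : {set T}) (rk : T -> nat) t :
  {in K &, injective rk} -> #|K| <= #|[set y in K | t <= rk y]| + t.
Proof.
move=> rkI; rewrite -(cardsID [set y | t <= rk y] K).
have -> : K :&: [set y | t <= rk y] = [set y in K | t <= rk y].
  by apply/setP => y; rewrite !inE.
rewrite leq_add2l cardE -(size_map rk) -{2}(size_iota 0 t); apply: uniq_leq_size.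
  rewrite map_inj_in_uniq ?enum_uniq // => x y; rewrite !mem_enum !inE.
  by move=> /andP[_ hx] /andP[_ hy]; apply: rkI.
by move=> k /mapP[y]; rewrite mem_enum !inE mem_iota => /andP[h _] ->; rewrite add0n; lia.
Qed.

(** The elements of [X] above [x] and up to [z] form a chain along which [btw lt X x] strictly
    increases. Its values there are distinct, so all but at most [t] of these elements are far from
    [x]. *)
Lemma bad_extremal_ge lt X t x z : interval_chain lt -> x \in X -> z \in X -> lt x z ->
  #|[set y in X | inc lt x y]| + (btw lt X x z + 1 - t) <= #|[set y in X | bad lt X t x y]|.
Proof.
move=> [ir tr ch] xX zX xz.
pose K := [set y in X | lt x y && ((y == z) || lt y z)].
have cK : #|K| = btw lt X x z + 1.
  have -> : K = z |: [set u in X | lt x u && lt u z].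
    apply/setP => u; rewrite !inE; case: (u =P z) => [->|] //=; by rewrite zX xz.
  by rewrite cardsU1 !inE ir !andbF addnC.
have mono y y' : y \in K -> lt y y' -> btw lt X x y < btw lt X x y'.
  rewrite !inE => /and3P[yX xy _] yy'; apply: proper_card; apply/properP; split.
    by apply/subsetP => u; rewrite !inE => /and3P[-> -> uy]; apply: tr yy'.
  by exists y; rewrite !inE ?yX ?xy ?yy' //= ir.
have rkI : {in K &, injective (btw lt X x)}.
  move=> y y' yK y'K e; apply/eqP/negP => /negP ne.
  suff: lt y y' || lt y' y.
    by case/orP => [/(mono _ _ yK)|/(mono _ _ y'K)]; rewrite e ltnn.
  move: (yK) (y'K) ne; rewrite !inE => /and3P[_ h1 h2] /and3P[_ h3 h4] ne.
  case/orP: h2 => [/eqP ey|h2]; case/orP: h4 => [/eqP ey'|h4].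
  - by rewrite ey ey' eqxx in ne.
  - by rewrite ey h4 orbT.
  - by rewrite ey' h2.
  - exact: ch h1 h2 h3 h4 ne.
have := injective_ge t rkI; rewrite cK => h.
have : #|[set y in X | inc lt x y]| + #|[set y in K | t <= btw lt X x y]|
    <= #|[set y in X | bad lt X t x y]|.
  rewrite -cardsUI (_ : _ :&: _ = set0) ?cards0 ?addn0; last first.
    apply/setP => y; rewrite !inE /inc; by case: (lt x y); rewrite ?andbF.
  apply/subset_leq_card/subsetP => y; rewrite !inE /bad /far => /orP[/andP[-> ->]//|].
  by move=> /andP[/and3P[-> -> _] ->]; rewrite orbT.
lia.
Qed.

(* Every element of [X] other than [x] and [z] is incomparable to one of them or lies in between. *)
Lemma bad_extremal_pair lt X t r x z : interval_chain lt -> x \in X -> z \in X -> lt x z ->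
    {in X, forall y, ~~ lt y x} -> {in X, forall y, ~~ lt z y} -> #|X| = t + r.+1 ->
  r <= #|[set y in X | bad lt X t x y]| + #|[set y in X | bad lt X t z y]|.
Proof.
move=> lc xX zX xz mx mz cX.
have h1 := bad_extremal_ge t lc xX zX xz.
have := bad_extremal_ge t (interval_chain_opp lc) zX xX xz.
under eq_finset do rewrite (inc_opp lt).
under [in leqRHS]eq_finset do rewrite (bad_opp lt).
rewrite (btw_opp lt) => h2.
have : #|X| <= #|[set y in X | inc lt x y]| + #|[set y in X | inc lt z y]|
      + btw lt X x z + #|[set x; z]|.
  apply: (@leq_trans #|([set y in X | inc lt x y] :|: [set y in X | inc lt z y])
      :|: [set u in X | lt x u && lt u z] :|: [set x; z]|).
    apply/subset_leq_card/subsetP => y yX; rewrite !inE yX /inc /=.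
    rewrite [x == y]eq_sym [z == y]eq_sym (negbTE (mx _ yX)) (negbTE (mz _ yX)) /=.
    by case: (y == x); case: (y == z); case: (lt x y); case: (lt y z).
  apply: leq_trans (leq_card_setU _ _) _; rewrite leq_add2r.
  apply: leq_trans (leq_card_setU _ _) _; rewrite leq_add2r.
  exact: leq_card_setU.
have : #|[set x; z]| <= 2 by rewrite cards2; case: (_ != _).
(* Let b be the number of elements in between. The incomparable pairs number at least
   [t + r - 1 - b]; this is enough if [b + 1 < t], and otherwise the two far contributions add
   [2 (b + 1 - t)]. *)
by rewrite cX; lia.
Qed.

Lemma minimal_below lt X g : irreflexive lt -> transitive lt -> g \in X ->
  exists x, [/\ x \in X, (x == g) || lt x g & {in X, forall y, ~~ lt y x}].
Proof.
move=> ir tr gX.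
pose P x := (x \in X) && ((x == g) || lt x g).
have Pg : P g by rewrite /P gX eqxx.
case: (@arg_minnP _ g P (fun x => #|[set u in X | lt u x]|) Pg) => x /andP[xX xg] xmin.
exists x; split=> // y yX; apply/negP => yx.
have Py : P y by rewrite /P yX; case/orP: xg => [/eqP <-|/(tr _ _ _ yx) ->]; rewrite ?yx orbT.
have := xmin y Py; rewrite leqNgt => /negP; apply; apply: proper_card; apply/properP; split.
  by apply/subsetP => u; rewrite !inE => /andP[-> uy]; apply: tr yx.
by exists y; rewrite !inE ?yX ?yx //= ir.
Qed.

(** Pairs are ordered here, hence the factor 2 in the bound [2 * Nr r]. *)
Definition nbad lt X t := #|[set p in setX X X | bad lt X t p.1 p.2]|.

(** As [x] lies between no two elements of [X], its deletion alters no [btw] and destroys just the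
    bad pairs containing [x], each counted in both orders. *)
Lemma nbad_remove lt X t x : irreflexive lt -> x \in X ->
    {in X &, forall u v, ~~ (lt u x && lt x v)} ->
  nbad lt (X :\ x) t + 2 * #|[set y in X | bad lt X t x y]| <= nbad lt X t.
Proof.
move=> ir xX nb; set B := [set y in X | _].
have eb u v : u \in X -> v \in X -> bad lt (X :\ x) t u v = bad lt X t u v.
  have e u' v' : u' \in X -> v' \in X -> btw lt (X :\ x) u' v' = btw lt X u' v'.
    move=> hu hv; apply: eq_card => w; rewrite !inE; case: (w =P x) => //= ->.
    by rewrite xX /= (negbTE (nb _ _ hu hv)).
  by move=> hu hv; rewrite /bad /far !e.
pose S0 := [set p in setX (X :\ x) (X :\ x) | bad lt (X :\ x) t p.1 p.2].
have c1 : #|[set (x, y) | y in B]| = #|B| by apply: card_imset => ? ? [].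
have c2 : #|[set (y, x) | y in B]| = #|B| by apply: card_imset => ? ? [].
have d12 : [set (x, y) | y in B] :&: [set (y, x) | y in B] = set0.
  apply/setP => -[u v]; rewrite !inE; apply/negP => /andP[/imsetP[y yB [_ ->]] /imsetP[y' _ [_ e]]].
  by move: yB; rewrite e inE bad_irr // andbF.
have d0 : S0 :&: ([set (x, y) | y in B] :|: [set (y, x) | y in B]) = set0.
  apply/setP => -[u v]; rewrite !inE /=; apply/negP => /andP[/andP[/andP[/andP[ux _] /andP[vx _]] _]].
  by case/orP => /imsetP[y _ [e1 e2]]; rewrite ?e1 ?e2 eqxx in ux vx.
rewrite mul2n -addnn -{1}c1 -c2 -[X in _ + X]cardsUI d12 cards0 addn0.
rewrite -[X in X <= _]cardsUI d0 cards0 addn0.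
apply/subset_leq_card/subsetP => -[u v]; rewrite !inE /=.
case/or3P => [/andP[/andP[/andP[_ uX] /andP[_ vX]]]|/imsetP[y]|/imsetP[y]].
- by rewrite uX vX eb.
- by rewrite !inE => /andP[yX h] [-> ->]; rewrite xX yX.
- by rewrite !inE => /andP[yX h] [-> ->]; rewrite xX yX badC.
Qed.

(** Induction on [r]: a minimal or a maximal element lies in at least as many bad pairs as the
    increment of [Nr]. It differs from [g], which lies in none, so [g] survives the deletion. *)
Lemma nbad_ge lt r X t g : interval_chain lt -> g \in X ->
    {in X, forall y, ~~ bad lt X t g y} -> #|X| = t + r.+1 ->
  2 * Nr r <= nbad lt X t.
Proof.
move=> lc; elim: r X => [|r IH] X gX gg cX; first by [].
have [ir tr ch] := lc.
have [x [xX xg xmin]] := minimal_below ir tr gX.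
have [ir' tr' _] := interval_chain_opp lc.
have [z [zX zg zmax]] := minimal_below ir' tr' gX.
(* If [x = g = z], any other element of [X] would be incomparable to [g]. *)
have xz : lt x z.
  case/orP: xg => [/eqP ex|xg]; case/orP: zg => [/eqP ez|zg].
  - have : 0 < #|X :\ g| by move: (cardsD1 g X); rewrite gX; lia.
    case/card_gt0P => y; rewrite !inE => /andP[yg yX].
    have := gg y yX; rewrite /bad /inc eq_sym yg /=.
    by have := xmin y yX; have := zmax y yX; rewrite ex ez /opp_rel => /negbTE -> /negbTE ->.
  - by rewrite ex.
  - by rewrite ez.
  - exact: tr xg zg.
have [xX' zX'] : {in X &, forall u v, ~~ (lt u x && lt x v)} /\ {in X &, forall u v, ~~ (lt u z && lt z v)}.
  by split=> u v uX vX; rewrite negb_and ?(xmin u uX) ?(zmax v vX) ?orbT.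
have hs := bad_extremal_pair lc xX zX xz xmin zmax cX.
have [w [wX wW hw]] : exists w, [/\ w \in X, {in X &, forall u v, ~~ (lt u w && lt w v)}
     & uphalf r.+1 <= #|[set y in X | bad lt X t w y]|].
  case: (leqP (uphalf r.+1) #|[set y in X | bad lt X t x y]|) => [hx|hx].
    by exists x.
  exists z; split=> //; move: hx hs.
  by have := uphalf_half r.+1; have := odd_double_half r.+1; lia.
have wg : w != g.
  apply/negP => /eqP e; move: hw; rewrite e leqNgt => /negP; apply.
  rewrite (_ : [set _ in _ | _] = set0) ?cards0 //.
  by apply/setP => y; rewrite !inE; apply/negP => /andP[yX]; apply/negP/gg.
rewrite NrS; apply: leq_trans (nbad_remove t ir wX wW).
rewrite mulnDr leq_add ?leq_pmul2l // IH //.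
- by rewrite !inE eq_sym wg.
- move=> y; rewrite !inE => /andP[_ yX]; apply: contra (gg y yX).
  rewrite /bad /far /btw.
  have sub u v : #|[set u0 in X :\ w | lt u u0 && lt u0 v]| <= #|[set u0 in X | lt u u0 && lt u0 v]|.
    by apply/subset_leq_card/subsetP => u0; rewrite !inE => /andP[/andP[_ ->]].
  by case/or3P => [->//|/andP[-> h]|/andP[-> h]]; rewrite (leq_trans h (sub _ _)) ?orbT.
- by move: (cardsD1 w X); rewrite wX cX; lia.
Qed.

End Poset.

(** * Counting incomparable pairs by depth *)

Section Depth.
Variable T : finType.
Implicit Types (lt : rel T) (g : T).

Definition downset lt g := [set y | (y == g) || lt y g].
Definition depth lt g y := #|[set u in downset lt g | lt y u]|.
Definition ninc lt := #|[set p | inc lt p.1 p.2]|.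

(** Take [x] of greatest depth [H]. The chain from [x] up to [g] has distinct depths at most [H];
    each of the other [A - 1] elements has depth at most [H], and at most [H - 1] unless it is
    deepest. This bounds the sum of depths, which is the number of comparable pairs, and the
    remaining pairs are incomparable. *)
Lemma downset_inc_ge lt g : interval_chain lt -> exists x H A,
  [/\ x \in downset lt g, depth lt g x = H, #|downset lt g| = H + A,
      0 < #|[set y in downset lt g | depth lt g y == H]| <= A
    & A * A + 2 * (A - #|[set y in downset lt g | depth lt g y == H]|) <=
       #|[set p in setX (downset lt g) (downset lt g) | inc lt p.1 p.2]| + A].
Proof.
move=> [ir tr ch]; set D := downset lt g; set d := depth lt g.
have gD : g \in D by rewrite inE eqxx.
have [x xD xmax] : exists2 x, x \in D & {in D, forall y, d y <= d x}.
  by case: (@arg_maxnP _ g (mem D) d gD) => x; exists x.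
exists x, (d x).
pose C := [set u in D | (u == x) || lt x u].
have cC : #|C| = (d x).+1.
  have -> : C = x |: [set u in D | lt x u].
    apply/setP => u; rewrite !inE; case: (u =P x) => [->|_] //=.
    by move: xD; rewrite inE => ->.
  by rewrite cardsU1 !inE ir andbF.
have mono u v : u \in D -> v \in D -> lt u v -> d v < d u.
  move=> uD vD uv; apply: proper_card; apply/properP; split.
    by apply/subsetP => w; rewrite !inE => /andP[-> vw]; apply: tr uv vw.
  by exists v; rewrite inE ?vD ?uv //= ir.
have CD u : u \in C -> u \in D by rewrite inE => /andP[].
have totC : {in C &, forall u v, u != v -> lt u v || lt v u}.
  move=> u v; rewrite !inE => /andP[uD xu] /andP[vD xv] uv.
  case/orP: xu => [/eqP ex|xu]; case/orP: xv => [/eqP ey|xv].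
  - by rewrite ex ey eqxx in uv.
  - by rewrite ex xv.
  - by rewrite ey xu orbT.
  case/orP: uD => [/eqP eu|ug]; case/orP: vD => [/eqP ev|vg].
  - by rewrite eu ev eqxx in uv.
  - by rewrite eu vg orbT.
  - by rewrite ev ug.
  - exact: ch xu ug xv vg uv.
have dI : {in C &, injective d}.
  move=> u v uC vC e; apply/eqP/negP => /negP ne.
  by case/orP: (totC u v uC vC ne) => /mono; rewrite e ltnn => /(_ (CD _ _) (CD _ _)) h;
    suff: false by []; apply: h.
have sumC : 2 * \sum_(u in C) d u <= d x * (d x).+1.
  have -> : \sum_(u in C) d u = \sum_(k <- [seq d u | u <- enum C]) k.
    by rewrite big_map big_enum.
  have : \sum_(k <- [seq d u | u <- enum C]) k <= \sum_(k <- iota 0 (d x).+1) k.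
    apply: sub_le_big_seq => //=.
    - by move=> *; apply: leq_addr.
    - move=> k; rewrite count_uniq_mem; last first.
        by rewrite map_inj_in_uniq ?enum_uniq // => u v; rewrite !mem_enum; apply: dI.
      rewrite count_uniq_mem ?iota_uniq //; case: mapP => // -[u].
      by rewrite mem_enum => uC ->; rewrite mem_iota; have := xmax u (CD u uC); lia.
  have -> : \sum_(k <- iota 0 (d x).+1) k = 'C((d x).+1, 2).
    by rewrite -bin2_sum /index_iota subn0.
  by move=> h; rewrite -double_bin2 leq_mul2l.
pose M := [set y in D | d y == d x].
have xM : x \in M by rewrite inE xD eqxx.
have CDs : C \subset D by apply/subsetP.
have cDC : #|D| = #|C| + #|D :\: C| by rewrite -(cardsID C D) (setIidPr CDs).
pose R := D :\: C.
have MC : #|M| = #|R :&: M|.+1.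
  have eM : M = x |: (R :&: M).
    apply/setP => y; rewrite in_setU1 in_setI in_setD; case: (y =P x) => [->|/eqP yx] //=.
    case yM: (y \in M); rewrite ?andbF // andbT.
    have /andP[yD /eqP dy] : (y \in D) && (d y == d x) by move: yM; rewrite inE.
    rewrite yD andbT inE yD (negbTE yx) /=; apply/esym/negP => xy.
    by have := mono x y xD yD xy; rewrite dy ltnn.
  have xC : x \in C by rewrite inE xD eqxx.
  by rewrite {1}eM cardsU1 in_setI /R in_setD xC.
have sumR : \sum_(y in R) d y + #|R| <= #|R| * d x + #|R :&: M|.
  rewrite -(cardsID M R) mulnDl.
  have -> : \sum_(y in R) d y = \sum_(y in R :&: M) d y + \sum_(y in R :\: M) d y.
    by rewrite (big_setID M).
  have h1 : \sum_(y in R :&: M) d y <= #|R :&: M| * d x.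
    rewrite -sum_nat_const; apply: leq_sum => y; rewrite !inE => /andP[_ /andP[_ /eqP ->]] //.
  have h2 : \sum_(y in R :\: M) d y + #|R :\: M| <= #|R :\: M| * d x.
    rewrite -[X in _ + X]sum1_card -big_split /= -sum_nat_const; apply: leq_sum => y.
    rewrite !inE => /and3P[nM _ yD]; rewrite addn1 ltn_neqAle xmax ?inE // andbT.
    by move: nM; rewrite yD.
  lia.
have sumD : \sum_(y in D) d y = \sum_(y in C) d y + \sum_(y in R) d y.
  by rewrite (big_setID C) /= (setIidPr CDs).
(* An ordered pair in [D] is diagonal, comparable in one of two directions, or incomparable. *)
have tot : #|D| * #|D| = #|D| + 2 * \sum_(y in D) d y
     + #|[set p in setX D D | inc lt p.1 p.2]|.
  have cnt (P : rel T) : #|[set p in setX D D | P p.1 p.2]| = \sum_(y in D) #|[set u in D | P y u]|.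
    rewrite -sum1dep_card (eq_bigl (fun p : T * T => (p.1 \in D) && ((p.2 \in D) && P p.1 p.2))).
      rewrite -(pair_big_dep (mem D) (fun y u => (u \in D) && P y u) (fun _ _ => 1)) /=.
      by apply: eq_bigr => y _; rewrite sum1dep_card.
    by move=> p; rewrite !inE andbA.
  have e1 : \sum_(y in D) d y = #|[set p in setX D D | lt p.1 p.2]| by rewrite (cnt lt).
  have e2 : #|[set p in setX D D | lt p.1 p.2]| = #|[set p in setX D D | lt p.2 p.1]|.
    have swI : injective (fun p : T * T => (p.2, p.1)) by move=> [? ?] [? ?] [-> ->].
    rewrite -(card_imset _ swI); apply: eq_card => -[u v].
    apply/imsetP/idP => [[[u' v'] h [-> ->]]|h].
      by move: h; rewrite !inE /= => /andP[/andP[-> ->]].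
    by exists (v, u) => //; move: h; rewrite !inE /= => /andP[/andP[-> ->]].
  have e3 : #|D| = #|[set p in setX D D | p.1 == p.2]|.
    have dI' : injective (fun y : T => (y, y)) by move=> y y' [].
    rewrite -(card_imset _ dI'); apply: eq_card => -[u v].
    apply/imsetP/idP => [[y yD [-> ->]]|]; first by rewrite inE in_setX /= yD eqxx.
    by rewrite !inE /= => /andP[/andP[h _] /eqP <-]; exists u => //; rewrite inE.
  rewrite -cardsX -(cardsID [set p | p.1 == p.2] (setX D D)) {1}e3 -addnA.
  congr (_ + _); first by apply: eq_card => p; rewrite !inE.
  rewrite -(cardsID [set p | lt p.1 p.2]) -(cardsID [set p | lt p.2 p.1] (_ :\: _ :\: _)) addnA.
  congr (_ + _).
    rewrite e1 mul2n -addnn {2}e2; congr (_ + _); apply: eq_card => -[u v]; rewrite !inE /=;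
      case: (u =P v) => [->|_]; rewrite ?ir ?andbF //=.
    case uv: (lt u v); case vu: (lt v u); rewrite ?andbF ?andbT //.
    by have := tr _ _ _ uv vu; rewrite ir.
  apply: eq_card => -[u v]; rewrite !inE /inc /=.
  by case: (u == v); case: (lt u v); case: (lt v u); rewrite ?andbF ?andbT.
exists (#|R|.+1); split=> //.
- by rewrite cDC cC addSnnS.
- rewrite -/M; apply/andP; split; first by apply/card_gt0P; exists x.
  by rewrite MC ltnS subset_leq_card // subsetIl.
rewrite -/M; move: tot; rewrite sumD cDC cC -/R; rewrite MC; move: sumR sumC.
have : #|R :&: M| <= #|R| by rewrite subset_leq_card // subsetIl.
move: (\sum_(y in R) _) (\sum_(y in C) _) (d x) #|R| #|R :&: M| #|[set p in _ | _]|.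
move=> sR sC h R' RM I; rewrite subSS => h1 h2 h3 h4.
nia.
Qed.

End Depth.

Section Weight.
Variable T : finType.
Implicit Types (lt : rel T) (g : T).

Lemma downset_opp lt g y : ~~ inc lt g y ->
  (y \in downset lt g) || (y \in downset (opp_rel lt) g).
Proof.
rewrite !inE /inc /opp_rel [g == y]eq_sym.
by case: (y == g); case: (lt y g); case: (lt g y).
Qed.

Lemma depth_top lt g : interval_chain lt -> depth lt g g = 0.
Proof.
case=> ir tr _; apply/eqP; rewrite cards_eq0 -subset0; apply/subsetP => u.
rewrite !inE => /andP[/orP[/eqP ->|ug]]; first by rewrite ir.
by move=> gu; have := tr _ _ _ gu ug; rewrite ir.
Qed.

(** One depth counts elements above [x] up to [g], the other elements from [g] to below [z]. All lie
    between [x] and [z], except that [g] is counted twice or is itself an endpoint; hence the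
    successor. *)
Lemma btw_depth_ge lt g x z : interval_chain lt ->
    x \in downset lt g -> z \in downset (opp_rel lt) g ->
    0 < depth lt g x + depth (opp_rel lt) g z ->
  lt x z /\ depth lt g x + depth (opp_rel lt) g z <= (btw lt setT x z).+1.
Proof.
move=> lc; have [ir tr _] := lc; have lc' := interval_chain_opp lc.
rewrite !inE => /orP[/eqP ->|xg] /orP[/eqP ->|gz].
- by rewrite !depth_top.
- rewrite (depth_top _ lc) add0n => _; split=> //.
  rewrite /depth (cardsD1 g) /opp_rel -add1n leq_add ?leq_b1 //.
  apply/subset_leq_card/subsetP => u; rewrite !inE => /andP[ug /andP[/orP[/eqP e|gu] uz]].
    by rewrite e eqxx in ug.
  by rewrite gu uz.
- rewrite (depth_top _ lc') addn0 => _; split=> //.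
  rewrite /depth (cardsD1 g) -add1n leq_add ?leq_b1 //.
  apply/subset_leq_card/subsetP => u; rewrite !inE => /andP[ug /andP[/orP[/eqP e|gu] uz]].
    by rewrite e eqxx in ug.
  by rewrite gu uz.
move=> _; split; first exact: tr xg gz.
rewrite /depth -cardsUI -addn1 leq_add //.
  apply/subset_leq_card/subsetP => u; rewrite !inE /opp_rel.
  case/orP => /andP[/orP[/eqP ->|h1] h2]; rewrite ?xg ?gz //.
    by rewrite h2 (tr _ _ _ h1 gz).
  by rewrite h2 (tr _ _ _ xg h1).
rewrite -(cards1 g); apply/subset_leq_card/subsetP => u; rewrite !inE /opp_rel.
case/andP => /andP[/orP[//|h1] _] /andP[/orP[//|h2] _].
by have := tr _ _ _ h1 h2; rewrite ir.
Qed.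

(** The sets below and above [g] share only [g], so [H + A + K + B = t + r + 2] for their greatest
    depths [H] and [K]. If [H + K] exceeds [t + 1], the deepest elements are very far apart; if it
    equals [t + 1], all pairs of deepest elements are far; if it is smaller, the incomparable pairs
    suffice. *)
Lemma far_or_weight lt g t r : interval_chain lt -> (forall y, ~~ inc lt g y) ->
    #|T| = t + r.+1 ->
  (exists x z, lt x z /\ t < btw lt setT x z) \/
  r./2.+1 * (2 * Nr r) <= r./2.+1 * ninc lt
     + #|[set p : T * T | far lt setT t p.1 p.2 || far lt setT t p.2 p.1]|.
Proof.
move=> lc gc cT; have [ir tr _] := lc; have lc' := interval_chain_opp lc.
set D := downset lt g; set U := downset (opp_rel lt) g.
have [x [H [A [xD dx cD hA iD]]]] := downset_inc_ge g lc.
have [z [K [B [zU dz cU hB iU]]]] := downset_inc_ge g lc'.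
move: hA iD hB iU; set a := #|_|; set iD := #|_|; set b := #|_|; set iU := #|_|.
move=> hA hiD hB hiU.
have gDU : D :&: U = [set g].
  apply/setP => u; rewrite !inE /opp_rel; case: (u =P g) => //= _.
  by apply/negP => /andP[h1 h2]; have := tr _ _ _ h1 h2; rewrite ir.
have DUT : D :|: U = setT.
  by apply/setP => u; rewrite in_setU in_setT; apply: downset_opp.
have cDU : H + A + (K + B) = (t + r.+1).+1.
  by rewrite -cD -cU -cardsUI -/D -/U gDU DUT cards1 cardsT cT addn1.
have inc_le : iD + iU <= ninc lt.
  rewrite /iD /iU -cardsUI (_ : _ :&: _ = set0) ?cards0 ?addn0.
    apply/subset_leq_card/subsetP => p; rewrite in_setU => /orP[]; rewrite inE => /andP[_ h]; rewrite inE //.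
    by rewrite (inc_opp lt) in h.
  apply/setP => -[u v]; rewrite inE in_set0; apply/negP => /andP[].
  rewrite inE in_setX => /andP[/andP[/= h1 h2] h3].
  rewrite inE in_setX => /andP[/andP[/= h1' h2'] _].
  have : u \in D :&: U by rewrite inE h1.
  have : v \in D :&: U by rewrite inE h2.
  rewrite gDU !inE => /eqP ev /eqP eu; move: h3; by rewrite ev eu /inc eqxx.
have [big|] := leqP t.+2 (H + K).
  left; exists x, z; have := btw_depth_ge lc xD zU; rewrite dx dz => -[|h1 h2]; first by lia.
  by split=> //; lia.
rewrite ltnS leq_eqVlt => /orP[/eqP eHK|small]; right.
  have hAB : A + B = r.+1 by lia.
  have := split_weight_ge (erefl _) hA hB hAB.
  pose M := [set y in D | depth lt g y == H]; pose N := [set y in U | depth (opp_rel lt) g y == K].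
  have hMN y w : y \in M -> w \in N -> far lt setT t y w.
    rewrite inE => /andP[yD /eqP dy]; rewrite inE => /andP[wU /eqP dw].
    have := btw_depth_ge lc yD wU; rewrite dy dw eHK => -[//|h1 h2].
    by rewrite /far h1.
  have : 2 * (a * b) <= #|[set p : T * T | far lt setT t p.1 p.2 || far lt setT t p.2 p.1]|.
    have swI : injective (fun p : T * T => (p.2, p.1)) by move=> [? ?] [? ?] [-> ->].
    rewrite mul2n -addnn -[a * b]cardsX -{2}(card_imset _ swI) -cardsUI.
    rewrite (_ : _ :&: _ = set0) ?cards0 ?addn0.
      apply/subset_leq_card/subsetP => -[u v]; rewrite in_setU => h; rewrite inE; case/orP: h => [|/imsetP[[u' v']]].
        by rewrite in_setX => /andP[/= h1 h2]; rewrite /= hMN.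
      by rewrite in_setX => /andP[/= h1 h2] [-> ->]; rewrite /= (hMN _ _ h1 h2) ?orbT.
    apply/setP => -[u v]; rewrite inE in_set0; apply/negP => /andP[].
    rewrite in_setX => /andP[/= h1 h2] /imsetP[[u' v']]; rewrite in_setX => /andP[/= h3 h4] [e1 e2].
    subst u v; have /andP[l1 _] := hMN _ _ h1 h2; have /andP[l2 _] := hMN _ _ h3 h4.
    by have := tr _ _ _ l1 l2; rewrite ir.
  move: #|_| (r./2.+1) => S L h1 h2.
  have : L * (A * A + 2 * (A - a) + (B * B + 2 * (B - b))) <= L * (ninc lt + A + B).
    by rewrite leq_mul2l; apply/orP; right; lia.
  lia.
apply: leq_trans (leq_addr _ _); rewrite leq_mul2l; apply/orP; right.
have := @split_ge r A B; move: hA hB => /andP[a0 aA] /andP[b0 bB].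
have -> : 0 < A by lia. have -> : 0 < B by lia.
have -> : r.+2 <= A + B by lia.
by move=> /(_ isT isT isT); lia.
Qed.
End Weight.

(** * Columns and the patterns they violate *)

Section Violations.
Variables (m : nat) (a : 'I_m -> 'I_m -> bool).
Implicit Types (x : column m 3) (S : {set 'I_m}) (A : simple_matrix m 3) (e f g : 'I_m).

(* [(a e f, a f e)] is the pattern chosen for the pair of rows [e], [f]; in the tree picture [a e f] is the
   side of the edge [e] that does not contain [f]. *)
Definition viol x e f := (x e == sym (a e f)) && (x f == sym (a f e)).
Definition nviol x := #|[set p : 'I_m * 'I_m | (p.1 < p.2) && viol x p.1 p.2]|.
Definition supp x := [set i | x i != two].
Definition good := [set x | nviol x == 0].
Definition sol S := [set x in good | supp x == S].
Definition single e f := [set x | viol x e f && (nviol x == 1)].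
Definition base := \sum_(S : {set 'I_m}) #|S|.+1.
(** In the tree picture: [e] separates [f] from [g], and [f] separates [e] from [g], which two tree
    edges cannot both do. *)
Definition conflict e f g := (a e f != a e g) && (a f e != a f g).
Definition treelike := forall e f g, e != f -> e != g -> f != g -> ~~ conflict e f g.
(** In the tree picture, the other edges that do not lie between [e] and [f]. *)
Definition outside e f := [set g | [&& g != e, g != f & a g e == a g f]].

Lemma violC x e f : viol x e f = viol x f e. Proof. exact: andbC. Qed.

Lemma goodP x : reflect (forall e f, e != f -> ~~ viol x e f) (x \in good).
Proof.
rewrite inE cards_eq0; apply: (iffP eqP) => [h e f ef|h].
  have lt_nv e' f' : e' < f' -> ~~ viol x e' f'.
    by move=> lt; have /setP/(_ (e', f')) := h; rewrite !inE /= lt /= => ->.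
  case: (ltngtP e f) => [/lt_nv//|/lt_nv|/val_inj e_f]; first by rewrite violC.
  by rewrite e_f eqxx in ef.
apply/setP => -[e f]; rewrite !inE /=; apply/negP => /andP[lt].
by apply/negP/h; apply: contraTneq lt => ->; rewrite ltnn.
Qed.

Lemma singleP x e f : e != f ->
  reflect (viol x e f /\ forall e' f', e' != f' -> viol x e' f' ->
             (e' = e /\ f' = f) \/ (e' = f /\ f' = e)) (x \in single e f).
Proof.
wlog lt : e f / e < f.
  move=> H ef; case: (ltngtP e f) => [|lt|/val_inj e_f]; last by rewrite e_f eqxx in ef.
    by move=> l; apply: H.
  have fe : f != e by rewrite eq_sym.
  have -> : (x \in single e f) = (x \in single f e) by rewrite !inE violC.
  apply: (iffP (H f e lt fe)).
  - by move=> [h1 h2]; rewrite violC; split=> // e' f' h3 /h2 -[] // [-> ->]; [right|left].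
  - by move=> [h1 h2]; rewrite violC; split=> // e' f' h3 /h2 -[] // [-> ->]; [right|left].
move=> ef; rewrite inE; apply: (iffP andP) => -[v h]; split=> //.
  case/cards1P: h => -[e0 f0] /setP h.
  have lt_eq e' f' : e' < f' -> viol x e' f' -> e' = e /\ f' = f.
    move=> l w; have := h (e, f); have := h (e', f').
    by rewrite !inE /= lt l v w => /esym/eqP[-> ->] /esym/eqP[-> ->].
  move=> e' f' ne w; case: (ltngtP e' f') => [l|l|/val_inj e_f].
  - by left; apply: lt_eq.
  - by right; have [] := lt_eq f' e' l; rewrite 1?violC.
  - by rewrite e_f eqxx in ne.
apply/cards1P; exists (e, f); apply/setP => -[e' f']; rewrite !inE /=.
apply/andP/eqP => [[l w]|[-> ->] //].
have ne : e' != f' by apply: contraTneq l => ->; rewrite ltnn.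
case: (h e' f' ne w) => -[e'E f'E]; rewrite e'E f'E in l * => //.
by move: (ltn_trans l lt); rewrite ltnn.
Qed.

Lemma sum_nviol A :
  \sum_(x in A) nviol x = \sum_(p : 'I_m * 'I_m | p.1 < p.2) #|[set x in A | viol x p.1 p.2]|.
Proof.
under eq_bigr => x _ do rewrite /nviol -sum1dep_card big_mkcondr /=.
rewrite exchange_big /=; apply: eq_bigr => p _.
by rewrite -sum1dep_card big_mkcondr.
Qed.

Lemma card_good : #|good| = \sum_S #|sol S|.
Proof.
rewrite -sum1_card (partition_big supp xpredT) //=; apply: eq_bigr => S _.
by rewrite -sum1dep_card.
Qed.

(* A column violating several pairs is counted at least twice by the first summand; a column violating
   exactly one pair is counted once by each summand. *)
Lemma double_violators_le A :
  2 * #|A :\: good| <= \sum_(p : 'I_m * 'I_m | p.1 < p.2)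
     (#|[set x in A | viol x p.1 p.2]| + #|A :&: single p.1 p.2|).
Proof.
have -> : \sum_(p : 'I_m * 'I_m | p.1 < p.2)
     (#|[set x in A | viol x p.1 p.2]| + #|A :&: single p.1 p.2|) =
   \sum_(x in A) nviol x + \sum_(x in [set x in A | nviol x == 1]) nviol x.
  rewrite !sum_nviol -big_split; apply: eq_bigr => p _; congr (_ + _).
  by apply: eq_card => x; rewrite !inE [X in _ && X]andbC andbA.
rewrite -sum1dep_card [X in _ <= _ + X](eq_bigl (fun x => (x \in A) && (nviol x == 1))); last first.
  by move=> x; rewrite inE.
rewrite [X in _ <= _ + X]big_mkcondr -big_split /= big_distrr /=.
rewrite [leqLHS](eq_bigl (fun x => (x \in A) && (nviol x != 0))); last first.
  by move=> x; rewrite !inE andbC.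
rewrite big_mkcondr; apply: leq_sum => x _; case: (nviol x) => [|[|n]] //=; lia.
Qed.

Lemma card_violators_le A :
  #|A :\: good| <= \sum_(p : 'I_m * 'I_m | p.1 < p.2) #|[set x in A | viol x p.1 p.2]|.
Proof.
rewrite -sum_nviol -sum1_card [leqLHS](eq_bigl (fun x => (x \in A) && (nviol x != 0))); last first.
  by move=> x; rewrite !inE andbC.
by rewrite big_mkcondr; apply: leq_sum => x _; case: (nviol x) => [|n].
Qed.

(* If both values at [s] extend a column of [sol (S :\ s)], then that column must have the entry
   [~~ a t s] at every other [t] of [S], so there is at most one such column. *)
Lemma sol_step S s : s \in S ->
  #|sol S| <= #|sol (S :\ s)| + 1 /\
  forall e f, e \in S :\ s -> f \in S :\ s -> e != f -> conflict e f s ->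
    #|sol S| <= #|sol (S :\ s)|.
Proof.
move=> sS.
pose er x : column m 3 := [ffun i => if i == s then two else x i].
pose P b := [set x in sol S | x s == sym b].
have solS x : x \in sol S -> x s != two.
  by rewrite inE => /andP[_ /eqP h]; rewrite -h inE in sS.
have eP : sol S = P true :|: P false.
  apply/setP => x; rewrite in_setU !inE -andb_orr; case: andP => //= h.
  case: (ord3P (x s)) => [e|[[] ->]]; rewrite ?eqxx ?orbT //.
  have /solS : x \in sol S by rewrite !inE; apply/andP.
  by rewrite e eqxx.
have cP b : #|P b| = #|er @: P b|.
  rewrite card_in_imset // => x y; rewrite !inE => /andP[_ /eqP xs] /andP[_ /eqP ys] e.
  apply/ffunP => i; case: (i =P s) => [->|/eqP /negbTE ne]; first by rewrite xs ys.
  by move/ffunP/(_ i): e; rewrite !ffunE ne.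
have er_sol b : er @: P b \subset sol (S :\ s).
  apply/subsetP => _ /imsetP[x xP ->]; move: xP; rewrite 2!inE => /andP[/andP[/goodP gx /eqP sx] _].
  rewrite inE; apply/andP; split; last first.
    by rewrite -sx; apply/eqP/setP => i; rewrite !inE ffunE; case: (i =P s); rewrite ?eqxx.
  apply/goodP => e f ef; apply: contra (gx e f ef); rewrite /viol !ffunE.
  case: ifP => _; first by rewrite [two == _]eq_sym sym_two.
  by case: ifP => _ //; rewrite [two == _]eq_sym sym_two andbF.
have forced y t : y \in er @: P true -> y \in er @: P false -> t \in S :\ s -> y t = sym (~~ a t s).
  have one b t' : y \in er @: P b -> t' \in S :\ s -> b = a s t' -> y t' = sym (~~ a t' s).
    move=> /imsetP[x xP ->]; move: xP; rewrite 2!inE => /andP[/andP[/goodP gx /eqP sx] /eqP xs].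
    rewrite !inE -sx inE ffunE => /andP[/negbTE ts x2] eb; rewrite ts.
    have := gx t' s; rewrite ts /viol xs eb eqxx andbT => /(_ isT) h.
    by case: (ord3P (x t')) x2 h => [->|[c ->]]; rewrite ?eqxx // (inj_eq sym_inj); case: c (a t' s) => [] [].
  move=> h1 h2 tS; case eb: (a s t).
    by apply: (one true).
  by apply: (one false).
have tot : #|sol S| <= #|sol (S :\ s)| + #|er @: P true :&: er @: P false|.
  rewrite eP; apply: leq_trans (leq_card_setU _ _) _; rewrite !cP -cardsUI leq_add2r.
  by apply/subset_leq_card; rewrite subUset !er_sol.
split.
  apply: leq_trans tot _; rewrite leq_add2l.
  have [y0 hy0] : exists y0, er @: P true :&: er @: P false \subset [set y0].
    exists [ffun t => if t \in S :\ s then sym (~~ a t s) else two].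
    apply/subsetP => y /setIP[y1 y2]; rewrite inE; apply/eqP/ffunP => t; rewrite ffunE.
    case: ifP => tS; first exact: forced.
    have := subsetP (er_sol true) y y1; rewrite inE => /andP[_ /eqP h].
    by apply/eqP/negP => /negP hh; rewrite -h inE hh in tS.
  by apply: leq_trans (subset_leq_card hy0) _; rewrite cards1.
(* A conflict means [~~ a e s = a e f] and [~~ a f s = a f e], so the forced column would violate
   the pair [e], [f]. *)
move=> e f eS fS ef /andP[c1 c2]; apply: leq_trans tot _.
rewrite (_ : _ :&: _ = set0) ?cards0 ?addn0 //; apply/setP => y; rewrite in_set0.
apply/negP => /setIP[y1 y2].
have := subsetP (er_sol true) y y1; rewrite inE => /andP[/goodP/(_ e f ef)/negP gy _]; apply: gy.
rewrite /viol !forced // !(inj_eq sym_inj).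
by move: c1 c2; case: (a e f); case: (a e s); case: (a f e); case: (a f s).
Qed.

Lemma card_sol_le S : #|sol S| <= #|S|.+1.
Proof.
move: {2}#|S| (erefl #|S|) => n; elim: n S => [|n IH] S cS.
  move/eqP: cS; rewrite cards_eq0 => /eqP ->.
  apply: (@leq_trans #|[set [ffun=> two] : column m 3]|); last by rewrite cards1.
  apply/subset_leq_card/subsetP => x; rewrite !inE => /andP[_ /eqP/setP h].
  apply/eqP/ffunP => i; rewrite ffunE; apply/eqP.
  by have := h i; rewrite !inE => /negbFE.
have /card_gt0P[s sS] : 0 < #|S| by rewrite cS.
have cS' : #|S :\ s| = n by move: (cardsD1 s S); rewrite sS; lia.
by have [h _] := sol_step sS; apply: leq_trans h _; rewrite addn1 ltnS cS -cS' IH.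
Qed.

Lemma card_sol_conflict S e f g : e != f -> e != g -> f != g -> conflict e f g ->
  [set e; f; g] \subset S -> #|sol S| <= #|S|.
Proof.
move=> ef eg fg cf /subsetP sub.
have gS : g \in S by apply: sub; rewrite !inE eqxx !orbT.
have [_ h] := sol_step gS.
apply: leq_trans (h e f _ _ ef cf) _.
- by rewrite !inE eg sub // !inE eqxx.
- by rewrite !inE fg sub // !inE eqxx orbT.
by apply: leq_trans (card_sol_le _) _; rewrite (cardsD1 g S) gS.
Qed.

Lemma card_good_le : #|good| <= base.
Proof. by rewrite card_good; apply: leq_sum => S _; apply: card_sol_le. Qed.

(** Every support containing all three rows loses a column. *)
Lemma card_good_conflict e f g : e != f -> e != g -> f != g -> conflict e f g ->
  #|good| + 2 ^ (m - 3) <= base.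
Proof.
move=> ef eg fg cf; pose E := [set e; f; g].
have cE : #|E| = 3.
  by rewrite /E setUC cardsU1 cards2 !inE ef negb_or eq_sym eg eq_sym fg.
have <- : #|[set S : {set 'I_m} | E \subset S]| = 2 ^ (m - 3).
  have cC : #|~: E| = m - 3 by rewrite cardsCs setCK card_ord cE.
  rewrite -cC -card_powerset -(card_imset _ (inv_inj (@setCK _))).
  apply: eq_card => S; apply/imsetP/idP => [[S']|].
    by rewrite !inE => h ->; rewrite setCS.
  by rewrite !inE => h; exists (~: S); rewrite ?setCK // inE -setCS setCK.
rewrite card_good -sum1dep_card [X in _ + X]big_mkcond -big_split /=.
apply: leq_sum => S _; case: ifP => h; last by rewrite addn0 card_sol_le.
by rewrite addn1 ltnS (card_sol_conflict ef eg fg cf).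
Qed.

(** At a row [g] between [e] and [f] both values create a further violation, so the entry is 2; at
    an outside row the only other choice is [~~ a g e]. The set of outside rows with this choice is
    arbitrary, since treelike patterns prevent violations among them. *)
Lemma card_single e f : treelike -> e != f -> #|single e f| = 2 ^ #|outside e f|.
Proof.
move=> tl ef.
pose phi S : column m 3 := [ffun g => if g == e then sym (a e f) else if g == f then sym (a f e)
  else if g \in S then sym (~~ a g e) else two].
have phiI : {in powerset (outside e f) &, injective phi}.
  move=> S S'; rewrite !inE => /subsetP hS /subsetP hS' eq_phi; apply/setP => g.
  have key (R : {set 'I_m}) : {subset R <= outside e f} -> (g \in R) = [&& g != e, g != f & phi R g != two].
    move=> hR; rewrite ffunE; case: (g =P e) => [eg|_] /=.
      by apply/negP => /hR; rewrite inE eg eqxx.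
    case: (g =P f) => [fg|_] /=; first by apply/negP => /hR; rewrite inE fg eqxx andbF.
    by case: ifP; rewrite ?sym_two ?eqxx.
  by rewrite (key S) // (key S') // eq_phi.
rewrite -card_powerset -(card_in_imset phiI); apply: eq_card => x.
have fe : f != e by rewrite eq_sym.
apply/(singleP _ ef)/imsetP => [[vx ux]|[S]]; last first.
  rewrite inE => /subsetP hS ->; have ve : viol (phi S) e f.
    by rewrite /viol !ffunE !eqxx (negbTE fe) !eqxx.
  split=> // g h gh.
  have out g' h' : g' != h' -> g' != e -> g' != f -> viol (phi S) g' h' -> False.
    move=> gh' ge gf; rewrite /viol ffunE (negbTE ge) (negbTE gf).
    case: ifP => [gS|_]; last by rewrite eq_sym sym_two.
    have := hS g' gS; rewrite inE => /and3P[_ _ /eqP ag].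
    rewrite (inj_eq sym_inj) ffunE.
    case: (h' =P e) => [->|/eqP he]; first by case: (a g' e).
    case: (h' =P f) => [->|/eqP hf]; first by rewrite -ag; case: (a g' e).
    case: ifP => [hS'|_]; last by rewrite [two == _]eq_sym sym_two andbF.
    rewrite (inj_eq sym_inj) => /andP[/eqP h1 /eqP h2].
    have := tl g' h' e gh' ge he; rewrite /conflict -h1 -h2.
    by case: (a g' e); case: (a h' e).
  move=> v; case: (g =P e) => [ge|/eqP ge].
    case: (h =P f) => [hf|/eqP hf]; first by left.
    have hg : h != g by rewrite eq_sym.
    by case: (out h g hg); rewrite // 1?violC // -ge.
  case: (g =P f) => [gf|/eqP gf]; last by case: (out g h gh ge gf v).
  case: (h =P e) => [he|/eqP he]; first by right.
  have hg : h != g by rewrite eq_sym.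
  by case: (out h g hg); rewrite // 1?violC // -gf.
exists (supp x :&: outside e f); first by rewrite inE subsetIr.
have /andP[/eqP xe /eqP xf] := vx.
apply/ffunP => g; rewrite ffunE; case: (g =P e) => [->//|/eqP ge].
case: (g =P f) => [->//|/eqP gf].
have nve : ~~ viol x g e.
  by apply/negP => /(ux _ _ ge) -[[g_e _]|[g_f _]]; [rewrite g_e eqxx in ge|rewrite g_f eqxx in gf].
have nvf : ~~ viol x g f.
  by apply/negP => /(ux _ _ gf) -[[g_e _]|[g_f _]]; [rewrite g_e eqxx in ge|rewrite g_f eqxx in gf].
rewrite !inE ge gf /=; case: (ord3P (x g)) => [->|[b xg]]; first by rewrite eqxx.
rewrite xg sym_two /=.
move: nve nvf; rewrite /viol xg xe xf !(inj_eq sym_inj).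
have := tl e f g ef; rewrite eq_sym ge eq_sym gf => /(_ isT isT).
have := tl e g f; rewrite eq_sym ge ef gf => /(_ isT isT isT).
have := tl f g e; rewrite eq_sym gf fe ge => /(_ isT isT isT).
rewrite /conflict.
by case: (a e f); case: (a e g); case: (a f e); case: (a f g); case: (a g e); case: (a g f); case: b {xg}.
Qed.

(** The [|S| + 1] vertices of the tree with edge set [S] give solutions: one end for each edge, and
    the second end of a root edge [rho]. *)
Lemma card_sol_ge S : treelike -> #|S|.+1 <= #|sol S|.
Proof.
move=> tl; case: (set_0Vmem S) => [->|[rho rS]].
  rewrite cards0; apply/card_gt0P; exists [ffun=> two]; rewrite inE; apply/andP; split.
    by apply/goodP => e f _; rewrite /viol ffunE eq_sym sym_two.
  by apply/eqP/setP => i; rewrite !inE ffunE eqxx.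
(* [z s false] and [z s true] are the two ends of the tree edge [s]; [y s] is the end away from the root. *)
pose z s b : column m 3 := [ffun t => if t \notin S then two else if t == s then sym b else sym (~~ a t s)].
have zS s b : s \in S -> z s b \in sol S.
  move=> sS; rewrite inE; apply/andP; split; last first.
    apply/eqP/setP => i; rewrite !inE ffunE; case: (i \in S); last by rewrite eqxx.
    by case: ifP; rewrite sym_two.
  apply/goodP => t t' tt'; rewrite /viol !ffunE.
  case: (t \in S); last by rewrite eq_sym sym_two.
  case: (t' \in S); last by rewrite [two == _]eq_sym sym_two andbF.
  rewrite /=; case: (t =P s) tt' => [->|/eqP ts] tt'.
    by rewrite [t' == s]eq_sym (negbTE tt') !(inj_eq sym_inj) andbC; case: (a t' s).
  case: (t' =P s) tt' => [->|/eqP t's] tt'; first by rewrite (inj_eq sym_inj); case: (a t s).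
  rewrite !(inj_eq sym_inj); have := tl t t' s tt' ts t's; rewrite /conflict.
  by case: (a t t'); case: (a t s); case: (a t' t); case: (a t' s).
pose y s := z s (a s rho).
have key s b : s \in S -> s != rho -> y s = z rho b -> False.
  move=> sS sr /ffunP/(_ s); rewrite !ffunE sS /= eqxx (negbTE sr) => /sym_inj.
  by case: (a s rho).
have yI : {in S &, injective y}.
  move=> s s' sS sS' eq_y; apply/eqP/negP => /negP ss'.
  have [sr|sr] := eqVneq s rho.
    have sr' : s' != rho by rewrite -sr eq_sym.
    by apply: (key s' (a rho rho) sS' sr'); rewrite -eq_y /y sr.
  have [sr'|sr'] := eqVneq s' rho.
    by apply: (key s (a rho rho) sS sr); rewrite eq_y /y sr'.
  move/ffunP: eq_y => eq_y; have := eq_y s; have := eq_y s'.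
  rewrite !ffunE sS sS' /= !eqxx (negbTE ss') [s' == s]eq_sym (negbTE ss') => /sym_inj h1 /sym_inj h2.
  have := tl s s' rho ss' sr sr'.
  by rewrite /conflict -h1 h2; case: (a s s'); case: (a s' s).
rewrite -(card_in_imset yI) -add1n.
have nz : z rho (~~ a rho rho) \notin y @: S.
  apply/negP => /imsetP[s sS /esym eq_y].
  have [sr|sr] := eqVneq s rho; last exact: key eq_y.
  by move/ffunP/(_ rho): eq_y; rewrite /y sr !ffunE rS /= eqxx => /sym_inj; case: (a rho rho).
apply: (@leq_trans #|z rho (~~ a rho rho) |: y @: S|); first by rewrite cardsU1 nz.
apply/subset_leq_card/subsetP => x; rewrite in_setU1.
by case/orP => [/eqP ->|/imsetP[s sS ->]]; apply: zS.
Qed.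

Lemma card_good_treelike : treelike -> base <= #|good|.
Proof. by move=> tl; rewrite card_good; apply: leq_sum => S _; apply: card_sol_ge. Qed.

End Violations.

(** * The upper bound *)

Definition npairs m := #|[set p : 'I_m * 'I_m | p.1 < p.2]|.
Definition budget (p q : nat) (u v : bool) := p - 1 - (if u == v then q else 0).

Lemma avoidP (p q m : nat) (A : simple_matrix m 3) : 0 < p -> q <= p - 1 ->
  reflect (forall i j, i != j -> exists u v, #|pats A i j u v| <= budget p q u v)
          (~~ configb (Fabcd (p - q) p p (p - q)) A).
Proof.
move=> p0 qp; have eb n u v : (cnt4 (p - q) p p (p - q) u v <= n) = ~~ (n <= budget p q u v).
  by rewrite /budget; case: u v => [] [] /=; lia.
apply: (iffP negP) => [h i j ij|h /Fabcd_configP[i [j [ij le_c]]]]; last first.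
  by have [u [v le_b]] := h i j ij; have := le_c u v; rewrite eb le_b.
have [/existsP[u /existsP[v le_b]]|/existsPn nh] :=
  boolP [exists u, exists v, #|pats A i j u v| <= budget p q u v]; first by exists u, v.
case: h; apply/Fabcd_configP; exists i, j; split=> // u v.
by have /existsPn/(_ v) := nh u; rewrite eb.
Qed.

Lemma sym_rel_card m (P : rel 'I_m) : symmetric P -> irreflexive P ->
  #|[set p | P p.1 p.2]| = 2 * #|[set p : 'I_m * 'I_m | (p.1 < p.2) && P p.1 p.2]|.
Proof.
move=> Ps Pi; rewrite -(cardsID [set p : 'I_m * 'I_m | p.1 < p.2]) mul2n -addnn; congr (_ + _).
  by apply: eq_card => p; rewrite !inE andbC.
have swI : injective (fun p : 'I_m * 'I_m => (p.2, p.1)) by move=> [? ?] [? ?] [-> ->].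
rewrite -[RHS](card_imset _ swI); apply: eq_card => -[e f].
rewrite !inE /= -leqNgt; apply/andP/imsetP => [[le_fe Pef]|[[f' e']]].
  exists (f, e) => //; rewrite inE /= Ps Pef andbT ltn_neqAle le_fe andbT.
  by apply: contraTneq Pef => /val_inj ->; rewrite Pi.
by rewrite inE /= => /andP[lt h] [-> ->]; rewrite Ps ltnW.
Qed.

Lemma sum_pairs_bool m (P : rel 'I_m) :
  \sum_(p : 'I_m * 'I_m | p.1 < p.2) (P p.1 p.2 : nat) = #|[set p : 'I_m * 'I_m | (p.1 < p.2) && P p.1 p.2]|.
Proof. by rewrite -sum1dep_card big_mkcondr. Qed.

(** Provides the row [g] for [nbad_ge] and [far_or_weight] whenever there are fewer pairs than
    rows. *)
Lemma exists_uncovered m (P : rel 'I_m) : #|[set p | P p.1 p.2]| < m -> exists g, forall y, ~~ P g y.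
Proof.
move=> lt_m; set C := [set p.1 | p in [set p | P p.1 p.2]].
have : #|C| < #|'I_m| by rewrite card_ord; apply: leq_ltn_trans (leq_imset_card _ _) lt_m.
rewrite -(cardC (mem C)) -addn1 leq_add2l => /card_gt0P[g gC].
exists g => y; apply: contraL gC => Pgy; rewrite inE negbK.
by apply/imsetP; exists (g, y); rewrite // inE.
Qed.

(** * The order on rows given by treelike patterns *)

Section Precedence.
Variables (m : nat) (a : 'I_m -> 'I_m -> bool).
Hypothesis tl : treelike a.

(** Orient each tree edge from its false to its true side: [f] is ahead of [e], and [e] is behind
    [f]. *)
Definition prec : rel 'I_m := fun e f => ~~ a e f && a f e.

Lemma inc_precE e f : inc prec e f = (e != f) && (a e f == a f e).
Proof. by rewrite /inc /prec; case: (a e f); case: (a f e); rewrite ?andbF ?andbT. Qed.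

Lemma prec_chain : interval_chain prec.
Proof.
have ir : irreflexive prec by move=> e; rewrite /prec andNb.
split=> // [f e g | x y y' z].
  case: (e =P f) => [->|/eqP ef]; first by rewrite ir.
  case: (f =P g) => [->|/eqP fg]; first by rewrite ir.
  case: (e =P g) => [->|/eqP eg].
    by rewrite /prec; case: (a g f); case: (a f g).
  have fe : f != e by rewrite eq_sym. have ge : g != e by rewrite eq_sym.
  have gf : g != f by rewrite eq_sym.
  have := tl fg fe ge; have := tl fe fg eg.
  by have := tl ef eg fg; have := tl gf ge fe; rewrite /conflict /prec;
     case: (a e f); case: (a f e); case: (a f g); case: (a g f); case: (a e g); case: (a g e).
(* The absence of a conflict with [x] excludes that [a y y'] and [a y' y] are both false, and with
   [z] that both are true. *)
move=> xy yz xy' y'z yy'.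
have nx w w' : prec w w' -> w != w' by apply: contraTneq => ->; rewrite ir.
have [x1 x2] := (nx _ _ xy, nx _ _ xy'); have [z1 z2] := (nx _ _ yz, nx _ _ y'z).
have y1 : y != x by rewrite eq_sym. have y2 : y' != x by rewrite eq_sym.
have := tl yy' y1 y2; have := tl yy' z1 z2; move: xy yz xy' y'z.
rewrite /prec /conflict.
by case: (a y y'); case: (a y' y); case: (a y x); case: (a y' x); case: (a y z); case: (a y' z);
   rewrite ?andbF.
Qed.

(** A row [u] in between has [a u e] true and [a u f] false, so it is not outside. *)
Lemma card_outside_le e f : prec e f -> #|outside a e f| + btw prec setT e f + 2 <= m.
Proof.
move=> ef; have [ir _ _] := prec_chain.
have nef : e != f by apply: contraTneq ef => ->; rewrite ir.
rewrite -[leqRHS](card_ord m) -[2](_ : #|[set e; f]| = 2); last by rewrite cards2 nef.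
rewrite -addnA /btw -cardsUI (_ : _ :&: [set e; f] = set0); last first.
  apply/setP => u; rewrite !inE /=; apply/negP => /andP[/andP[eu uf] /orP[] /eqP uE].
    by rewrite uE ir in eu.
  by rewrite uE ir in uf.
rewrite cards0 addn0 -cardsUI (_ : outside a e f :&: _ = set0) ?cards0 ?addn0 ?max_card //.
apply/setP => u; rewrite !inE; apply/negP => /andP[/and3P[ue uf /eqP au]].
rewrite (negbTE ue) (negbTE uf) !orbF /prec au.
by case: (a u f); rewrite ?andbF ?andbT.
Qed.

End Precedence.

(** * Losses against the budgets of the pairs *)

Section UpperBound.
Variables (p q m : nat) (A : simple_matrix m 3) (a : 'I_m -> 'I_m -> bool).
Hypothesis leA : forall e f : 'I_m, e != f ->
  #|[set x in A | viol a x e f]| <= budget p q (a e f) (a f e).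
Hypothesis qp : q <= p - 1.

Local Notation n e f := #|[set x in A | viol a x e f]|.
Local Notation s e f := #|A :&: single a e f|.

Lemma violators_sum_le :
  \sum_(c : 'I_m * 'I_m | c.1 < c.2) n c.1 c.2 <= (p - 1) * npairs m.
Proof.
rewrite mulnC -sum_nat_const big_mkcond [leqRHS]big_mkcond; apply: leq_sum => c _; rewrite inE.
case: ifP => // lt; apply: leq_trans (leA _) (leq_subr _ _).
by apply: contraTneq lt => ->; rewrite ltnn.
Qed.

Lemma weak_upper : #|A| <= base m + (p - 1) * npairs m.
Proof.
rewrite -(cardsID (good a)) leq_add //.
  by apply: leq_trans (card_good_le a); rewrite subset_leq_card // subsetIr.
exact: leq_trans (card_violators_le _ _) violators_sum_le.
Qed.

Lemma conflict_upper N : N <= 2 ^ (m - 3) -> ~ treelike a -> #|A| + N <= base m + (p - 1) * npairs m.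
Proof.
move=> hN ntl.
have [/existsP[e /existsP[f /existsP[g /and4P[ef eg fg cf]]]]|H] :=
  boolP [exists e, exists f, exists g, [&& e != f, e != g, f != g & conflict a e f g]].
  have := card_good_conflict ef eg fg cf; rewrite -(cardsID (good a) A).
  have := leq_trans (card_violators_le a A) violators_sum_le.
  have : #|A :&: good a| <= #|good a| by rewrite subset_leq_card // subsetIr.
  by move: hN; move: (2 ^ _) ((p - 1) * _) #|_ :&: _| #|_ :\: _| #|good a| => *; lia.
case: ntl => e f g ef eg fg; apply/negP => cf; case/negP: H.
by apply/existsP; exists e; apply/existsP; exists f; apply/existsP; exists g; rewrite ef eg fg.
Qed.

(** Weights are measured in half columns, because [double_violators_le] bounds twice the number of
    violating columns. *)
Lemma weighted_upper (w : 'I_m -> 'I_m -> nat) N :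
    (forall e f : 'I_m, e < f -> n e f + s e f + w e f <= 2 * (p - 1)) ->
    2 * N <= \sum_(c : 'I_m * 'I_m | c.1 < c.2) w c.1 c.2 ->
  #|A| + N <= base m + (p - 1) * npairs m.
Proof.
move=> hw; set W := \sum_(c | _) w _ _ => hN.
have := double_violators_le a A; set V := \sum_(c | _) _ => hV.
have hVW : V + W <= 2 * ((p - 1) * npairs m).
  rewrite mulnA mulnC -sum_nat_const -big_split big_mkcond [leqRHS]big_mkcond.
  apply: leq_sum => c _; rewrite inE; case: ifP => // lt; apply: hw => //.
have hg := card_good_le a; have hA := cardsID (good a) A.
have : #|A :&: good a| <= #|good a| by rewrite subset_leq_card // subsetIr.
move: V W hV hVW hN hg; rewrite -hA.
move: ((p - 1) * _) #|_ :&: _| #|_ :\: _| #|good a| => *; lia.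
Qed.

Hypothesis tl : treelike a.
Local Notation lt := (prec a).

Lemma inc_loss e f : inc lt e f -> n e f + s e f + 2 * q <= 2 * (p - 1).
Proof.
rewrite inc_precE => /andP[ef /eqP h]; have := leA ef; rewrite /budget h eqxx.
have : s e f <= n e f.
  by apply/subset_leq_card/subsetP => x; rewrite !inE => /andP[-> /andP[->]].
lia.
Qed.

Lemma violC_card e f : n e f + s e f = n f e + s f e.
Proof. by congr (_ + _); apply: eq_card => x; rewrite !inE violC. Qed.

(** At most [k] rows are outside, so [card_single] leaves at most [2 ^ k] columns violating this
    pair only. *)
Lemma prec_loss e f k : lt e f -> m <= k + 2 + btw lt setT e f -> n e f + s e f <= p - 1 + 2 ^ k.
Proof.
move=> ef hk; have ne : e != f by apply: contraTneq ef => ->; rewrite /prec andNb.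
have := card_outside_le tl ef => ho.
apply: leq_add; first by apply: leq_trans (leA ne) (leq_subr _ _).
apply: leq_trans (subset_leq_card (subsetIr _ _)) _.
by rewrite card_single // leq_exp2l //; lia.
Qed.

Lemma far_loss e f t k : m = t + k.+2 -> far lt setT t e f || far lt setT t f e ->
  n e f + s e f <= p - 1 + 2 ^ k.
Proof.
by move=> mE /orP[] /andP[l h]; last rewrite violC_card; apply: prec_loss => //; lia.
Qed.

Lemma sum_weight (P : rel 'I_m) w : symmetric P -> irreflexive P ->
  2 * \sum_(c : 'I_m * 'I_m | c.1 < c.2) w * P c.1 c.2 = w * #|[set c | P c.1 c.2]|.
Proof. by move=> Ps Pi; rewrite sym_rel_card // -big_distrr /= sum_pairs_bool mulnCA. Qed.

(** Condition (i) with [r = k.+1]: every bad pair, far or incomparable, loses at least [q]. *)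
Lemma bad_upper t k : m = t + k.+2 -> 2 * Nr k.+1 < m -> 2 ^ k + 2 * q <= p - 1 ->
  #|A| + q * Nr k.+1 <= base m + (p - 1) * npairs m.
Proof.
move=> mE ltm hp; have lc := prec_chain tl; have [ir _ _] := lc.
have badE : #|[set c | bad lt setT t c.1 c.2]| = nbad lt setT t.
  by apply: eq_card => c; rewrite !inE.
have bad_ge : 2 * Nr k.+1 <= #|[set c | bad lt setT t c.1 c.2]|.
  rewrite leqNgt; apply/negP => lt_bad.
  have [g gP] := exists_uncovered (ltn_trans lt_bad ltm).
  move: lt_bad; rewrite badE ltnNge => /negP; apply.
  by apply: (nbad_ge lc (in_setT g)) => [y _|]; [apply: gP|rewrite cardsT card_ord].
apply: (weighted_upper (w := fun e f => 2 * q * bad lt setT t e f)) => [e f ef|].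
  case: (boolP (bad _ _ _ _ _)) => [|_]; rewrite ?muln1 ?muln0 ?addn0.
    case/or3P => [|h|h]; first exact: inc_loss.
    - by have := @far_loss e f t k mE; rewrite h => /(_ isT); lia.
    by have := @far_loss e f t k mE; rewrite h orbT => /(_ isT); lia.
  have ne : e != f by apply: contraTneq ef => ->; rewrite ltnn.
  have : s e f <= n e f.
    by apply/subset_leq_card/subsetP => x; rewrite !inE => /andP[-> /andP[->]].
  by have := leA ne; rewrite /budget; lia.
rewrite -(leq_pmul2l (isT : 0 < 2)) sum_weight; last 2 first.
- by move=> e f; apply: badC.
- by move=> e; apply: bad_irr.
by rewrite -mulnA leq_pmul2l // mulnCA leq_mul2l bad_ge orbT.
Qed.

Lemma budget_loss (e f : 'I_m) : e < f -> n e f + s e f <= 2 * (p - 1).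
Proof.
move=> ef; have ne : e != f by apply: contraTneq ef => ->; rewrite ltnn.
have : s e f <= n e f.
  by apply/subset_leq_card/subsetP => x; rewrite !inE => /andP[-> /andP[->]].
by have := leA ne; rewrite /budget; lia.
Qed.

Lemma inc_upper N : 2 * N <= ninc lt -> #|A| + q * N <= base m + (p - 1) * npairs m.
Proof.
move=> hN; apply: (weighted_upper (w := fun e f => 2 * q * inc lt e f)) => [e f ef|].
  case: (boolP (inc _ _ _)) => [|_]; rewrite ?muln1 ?muln0 ?addn0; first exact: inc_loss.
  exact: budget_loss.
rewrite -(leq_pmul2l (isT : 0 < 2)) sum_weight; last 2 first.
- by move=> e f; apply: incC.
- by move=> e; rewrite /inc eqxx.
by rewrite -mulnA leq_pmul2l // mulnCA leq_mul2l hN orbT.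
Qed.

(** A single pair with enough rows in between pays for the whole loss [N]. *)
Lemma very_far_upper x z k N : lt x z -> m <= k + 2 + btw lt setT x z ->
  2 ^ k + 2 * N <= p - 1 -> #|A| + N <= base m + (p - 1) * npairs m.
Proof.
move=> xz hk hN.
pose P e f := ((e, f) == (x, z)) || ((e, f) == (z, x)).
apply: (weighted_upper (w := fun e f => 2 * N * P e f)) => [e f ef|].
  case: (boolP (P _ _)) => [|_]; rewrite ?muln1 ?muln0 ?addn0; last exact: budget_loss.
  by case/orP => /eqP[-> ->]; last rewrite violC_card; have := prec_loss xz hk; lia.
have ne : x != z by apply: contraTneq xz => ->; rewrite /prec andNb.
rewrite -(leq_pmul2l (isT : 0 < 2)) sum_weight; last 2 first.
- by move=> e f; rewrite /P !xpair_eqE orbC andbC [X in _ || X]andbC.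
- move=> e; rewrite /P !xpair_eqE; apply/negP => /orP[] /andP[/eqP e1 /eqP e2];
    by rewrite -e1 -e2 eqxx in ne.
rewrite (_ : [set c | _] = [set (x, z); (z, x)]).
  by rewrite cards2 xpair_eqE negb_and ne mulnC.
by apply/setP => -[e f]; rewrite !inE.
Qed.

(** Condition (ii) with [r = k.+1]: a far pair may lose less than [q], so far pairs get the weight
    [p - 1 - 2 ^ k] and [far_or_weight] balances them against the incomparable pairs. *)
Lemma far_upper t k : m = t + k.+2 -> 2 * Nr k.+1 < m -> 2 ^ k <= p - 1 ->
    8 * (q * Nr k.+1) <= 2 ^ k.+1 -> 2 * q <= k.+1./2.+1 * (p - 1 - 2 ^ k) ->
  #|A| + q * Nr k.+1 <= base m + (p - 1) * npairs m.
Proof.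
move=> mE ltm hp hN hq; have lc := prec_chain tl; have [ir tr _] := lc.
case: (leqP (2 * Nr k.+1) (ninc lt)) => [|lt_inc]; first exact: inc_upper.
have [g gP] := exists_uncovered (ltn_trans lt_inc ltm).
have cT : #|'I_m| = t + k.+1.+1 by rewrite card_ord.
case: (far_or_weight lc gP cT) => [[x [z [xz hxz]]]|hw].
  have := card_outside_le tl xz => ho.
  (* More than [t] rows in between leave at most [k - 1] outside; as [2 q N_r <= 2 ^ (k - 1)], the
     pair loses enough when [2 ^ k <= p - 1]. *)
  have [k' kE] : exists k', k = k'.+1 by exists k.-1; lia.
  apply: (very_far_upper (k := k') xz); first by lia.
  by move: hN hp; rewrite kE !expnS; lia.
pose D := p - 1 - 2 ^ k; pose F e f := far lt setT t e f || far lt setT t f e.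
have Fs : symmetric F by move=> e f; rewrite /F orbC.
have Fi : irreflexive F by move=> e; rewrite /F /far ir.
apply: (weighted_upper (w := fun e f => 2 * q * inc lt e f + D * F e f)) => [e f ef|].
  case: (boolP (inc _ _ _)) => [h|_].
    have -> : F e f = false.
      by move: h; rewrite /F /far /inc => /and3P[_ /negbTE -> /negbTE ->].
    by rewrite muln1 muln0 addn0; apply: inc_loss.
  rewrite muln0 add0n; case: (boolP (F e f)) => [h|_]; rewrite ?muln1 ?muln0 ?addn0.
    by have := far_loss mE h; rewrite /D; lia.
  exact: budget_loss.
have L0 : 0 < k.+1./2.+1 by [].
rewrite big_split /= -(leq_pmul2l (isT : 0 < 2)) -(leq_pmul2l L0) mulnDr !sum_weight //; last 2 first.
- by move=> e f; apply: incC.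
- by move=> e; rewrite /inc eqxx.
move: hw hq; rewrite -/D -/(ninc lt).
rewrite (_ : #|[set c | F c.1 c.2]| = #|[set c : 'I_m * 'I_m | far lt setT t c.1 c.2 || far lt setT t c.2 c.1]|) //.
move: (_.+1) (Nr _) D (ninc lt) #|_| => L M D I G hw hq.
have h1 : 2 * q * G <= L * D * G by rewrite leq_mul2r hq orbT.
have h2 : 2 * q * (L * (2 * M)) <= 2 * q * (L * I + G) by rewrite leq_mul2l hw orbT.
nia.
Qed.

End UpperBound.

(** * The lower bound *)

Lemma choose_pattern (p q m : nat) (A : simple_matrix m 3) :
    (forall i j, i != j -> exists u v, #|pats A i j u v| <= budget p q u v) ->
  exists a : 'I_m -> 'I_m -> bool, forall e f : 'I_m, e != f ->
    #|[set x in A | viol a x e f]| <= budget p q (a e f) (a f e).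
Proof.
move=> hA.
pose ok e f (w : bool * bool) := #|pats A e f w.1 w.2| <= budget p q w.1 w.2.
pose pk e f := odflt (true, true) [pick w | ok e f w].
have pkP e f : e != f -> ok e f (pk e f).
  move=> /hA[u [v h]]; rewrite /pk; case: pickP => //= /(_ (u, v)).
  by rewrite /ok h.
(* Both orders of a pair must read off the same chosen pattern. *)
pose a (e f : 'I_m) := if e < f then (pk e f).1 else (pk f e).2.
exists a => e f; wlog lt : e f / e < f => [H ne|ne].
  case: (ltngtP e f) => [l|l|/val_inj E]; first exact: H.
    have -> : #|[set x in A | viol a x e f]| = #|[set x in A | viol a x f e]|.
      by apply: eq_card => x; rewrite !inE violC.
    by rewrite /budget eq_sym; apply: H; rewrite // eq_sym.
  by rewrite E eqxx in ne.
have := pkP e f ne; rewrite /ok /pats /viol /a lt.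
by have -> : (f < e) = false by lia.
Qed.

Lemma card_ord_lt m k : k <= m -> #|[set e : 'I_m | e < k]| = k.
Proof.
move=> km; rewrite -sum1_card (eq_bigl (fun e : 'I_m => e < k)); last by move=> e; rewrite inE.
rewrite -(big_ord_widen _ (fun=> 1) km).
by rewrite sum_nat_const card_ord muln1.
Qed.

Section LowerBound.
Variables (m A B : nat).
Hypothesis ABm : A + B <= m.

(* In the induced order the first [A] rows are minimal, the last [B] rows are maximal, and all other
   pairs of rows are ordered as in ['I_m]. *)
Definition broom (e f : 'I_m) := (m - B <= e) || ((A <= e) && (f < e)).

Lemma broom_treelike : treelike broom.
Proof.
move=> e f g ef eg fg; rewrite /conflict /broom.
have [n1 n2 n3] : [/\ e <> f :> nat, e <> g :> nat & f <> g :> nat].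
  by split=> /val_inj E; rewrite E eqxx in ef eg fg.
by lia.
Qed.

(** For each of the [A + B] extremal rows [g] the value [broom g] is constant, so [g] lies between
    no two rows. *)
Lemma broom_outside e f : e != f -> A + B - 2 <= #|outside broom e f|.
Proof.
move=> ef; pose X := [set g : 'I_m | g < A] :|: ~: [set g : 'I_m | g < m - B].
have cX : #|X| = A + B.
  have cB : #|~: [set g : 'I_m | g < m - B]| = B.
    by rewrite cardsCs setCK card_ord card_ord_lt ?leq_subr //; lia.
  rewrite /X cardsU cB card_ord_lt; last by lia.
  rewrite (_ : _ :&: _ = set0) ?cards0; first by lia.
  by apply/setP => u; rewrite !inE; apply/negP; lia.
have : #|X| <= #|outside broom e f| + #|[set e; f]|.
  apply: leq_trans (leq_card_setU _ _); apply/subset_leq_card/subsetP => u; rewrite !inE /broom.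
  case: (u =P e) => [->|/eqP ue]; first by rewrite !orbT.
  case: (u =P f) => [->|/eqP uf]; first by rewrite !orbT.
  rewrite /= !orbF => h; lia.
by rewrite cX cards2 ef; lia.
Qed.

Lemma broom_equal : #|[set c : 'I_m * 'I_m | (c.1 < c.2) && (broom c.1 c.2 == broom c.2 c.1)]|
   <= 'C(A, 2) + 'C(B, 2).
Proof.
have cP k : k <= m -> #|[set c : 'I_m * 'I_m | (c.1 < c.2) && (c.2 < k)]| <= 'C(k, 2).
  move=> km; rewrite -sum1_card.
  rewrite (reindex (fun c : 'I_m * 'I_m => (c.2, c.1))) /=; last first.
    by exists (fun c : 'I_m * 'I_m => (c.2, c.1)) => -[].
  rewrite (eq_bigl (fun c : 'I_m * 'I_m => (c.1 < k) && (c.2 < c.1))); last by move=> c; rewrite inE andbC.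
  rewrite -(pair_big_dep (fun f : 'I_m => f < k) (fun f e : 'I_m => e < f) (fun _ _ => 1)) /=.
  under eq_bigr => f _ do rewrite sum1dep_card card_ord_lt ?(ltnW (ltn_ord f)) //.
  by rewrite -(big_ord_widen _ id km) -bin2_sum big_mkord.
(* Reversing the rows and swapping turns increasing pairs among the last [B] rows into increasing
   pairs among the first [B]. *)
pose rv (c : 'I_m * 'I_m) := (rev_ord c.2, rev_ord c.1).
have rvI : injective rv by move=> [e f] [e' f'] [] h1 h2; congr (_, _); apply: val_inj;
  have := ltn_ord e; have := ltn_ord f; have := ltn_ord e'; have := ltn_ord f'; rewrite /= in h1 h2 *; lia.
apply: leq_trans (leq_add (cP A _) (cP B _)); try lia.
rewrite -[X in _ <= _ + X](card_preimset _ rvI).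
apply: leq_trans (leq_card_setU _ _); apply/subset_leq_card/subsetP => -[e f].
rewrite !inE /broom /=; have := ltn_ord e; have := ltn_ord f; lia.
Qed.

(** Take all good columns and, for each pair, as many columns violating that pair only as its budget
    allows; [broom_outside] guarantees that there are enough. *)
Lemma lower_bound p q : p - 1 <= 2 ^ (A + B - 2) -> q <= p - 1 ->
  exists X : simple_matrix m 3,
   (forall i j, i != j -> exists u v, #|pats X i j u v| <= budget p q u v) /\
   base m + (p - 1) * npairs m <= #|X| + q * ('C(A, 2) + 'C(B, 2)).
Proof.
move=> hp hq.
pose a := broom; have tl : treelike a := broom_treelike.
pose bud (c : 'I_m * 'I_m) := budget p q (a c.1 c.2) (a c.2 c.1).
pose E (c : 'I_m * 'I_m) := [set x in take (bud c) (enum (single a c.1 c.2))].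
have sE c : E c \subset single a c.1 c.2.
  by apply/subsetP => x; rewrite inE => /mem_take; rewrite mem_enum.
have cE (c : 'I_m * 'I_m) : c.1 < c.2 -> #|E c| = bud c.
  move=> lt; have ne : c.1 != c.2 by apply: contraTneq lt => ->; rewrite ltnn.
  rewrite cardsE (card_uniqP _) ?take_uniq ?enum_uniq // size_takel // -cardE card_single //.
  rewrite /bud /budget; apply: leq_trans (leq_subr _ _) _; apply: leq_trans hp _.
  by rewrite leq_exp2l // broom_outside.
pose X := good a :|: \bigcup_(c : 'I_m * 'I_m | c.1 < c.2) E c.
have XP x : x \in X -> x \in good a \/ exists2 c : 'I_m * 'I_m, c.1 < c.2 & x \in E c.
  by rewrite inE => /orP[|/bigcupP[c]]; [left|right; exists c].
have violX (e f : 'I_m) : e < f -> [set x in X | viol a x e f] = E (e, f).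
  move=> lt; have ne : e != f by apply: contraTneq lt => ->; rewrite ltnn.
  apply/setP => x; rewrite inE; apply/andP/idP => [[xX v]|xE].
    case: (XP x xX) => [/goodP/(_ e f ne)|[[e' f'] /= lt' xE]]; first by rewrite v.
    have ne' : e' != f' by apply: contraTneq lt' => ->; rewrite ltnn.
    have /(singleP _ _ ne')[_ h] := subsetP (sE _) _ xE.
    by case: (h e f ne v) => -[eE fE]; rewrite eE fE in lt *; last lia.
  split; first by rewrite inE; apply/orP; right; apply/bigcupP; exists (e, f).
  by have /(singleP _ _ ne)[] := subsetP (sE _) _ xE.
exists X; split=> [i j ij|].
  wlog lt : i j ij / i < j => [H|].
    case: (ltngtP i j) => [l|l|/val_inj e]; first exact: H.
      have ji : j != i by rewrite eq_sym.
      by have [u [v h]] := H j i ji l; exists v, u; rewrite patsC /budget eq_sym.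
    by rewrite e eqxx in ij.
  exists (a i j), (a j i); rewrite -[budget _ _ _ _]/(bud (i, j)) -cE // -violX //.
have cX : #|good a| + \sum_(c : 'I_m * 'I_m | c.1 < c.2) bud c <= #|X|.
  rewrite -(cardsID (good a) X) leq_add //.
    by apply/subset_leq_card/subsetP => x h; rewrite in_setI h andbT /X in_setU h.
  have -> : \sum_(c : 'I_m * 'I_m | c.1 < c.2) bud c = \sum_(x in X) nviol a x.
    by rewrite sum_nviol; apply: eq_bigr => -[e f] lt; rewrite violX // cE.
  rewrite -[leqRHS]sum1_card [leqRHS](eq_bigl (fun x => (x \in X) && (x \notin good a))); last first.
    by move=> x; rewrite in_setD andbC.
  rewrite [leqRHS]big_mkcondr; apply: leq_sum => x /XP[xg|[c lt xE]].
    by rewrite xg; move: xg; rewrite inE => /eqP ->.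
  have := subsetP (sE c) x xE; rewrite inE => /andP[_ /eqP n1].
  by rewrite n1 inE n1.
have hb : (p - 1) * npairs m <= \sum_(c : 'I_m * 'I_m | c.1 < c.2) bud c + q * ('C(A, 2) + 'C(B, 2)).
  apply: (@leq_trans (\sum_(c : 'I_m * 'I_m | c.1 < c.2) (bud c + q * (a c.1 c.2 == a c.2 c.1)))).
    rewrite mulnC -sum_nat_const big_mkcond [leqRHS]big_mkcond; apply: leq_sum => c _; rewrite inE.
    by case: ifP => // _; rewrite /bud /budget; case: eqP; lia.
  rewrite big_split /= leq_add2l -big_distrr leq_mul2l /=; apply/orP; right.
  by rewrite (sum_pairs_bool (fun e f => a e f == a f e)) broom_equal.
have hg := card_good_treelike tl.
apply: leq_trans (leq_add hg hb) _; rewrite addnA leq_add2r; exact: cX.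
Qed.

End LowerBound.

(** * The formula for forb *)

Lemma Nr_ge r : r <= Nr r.
Proof. by elim: r => // r IH; rewrite NrS /= -addn1 leq_add. Qed.

(** With [q <= 2 ^ r] and [m >= 2 N_r + 2] this gives [q N_r <= 2 ^ (m - 3)], as [conflict_upper]
    requires. *)
Lemma pow_Nr r : 0 < r -> 2 ^ r * Nr r <= 2 ^ (2 * Nr r - 1).
Proof.
move=> r0; have h := Nr_ge r.
apply: (@leq_trans (2 ^ r * 2 ^ (Nr r).-1)).
  rewrite leq_mul2l; apply/orP; right; case: (Nr r) => // n /=.
  exact: ltn_expl.
by rewrite -expnD leq_exp2l //; lia.
Qed.

(** Conditions (i) and (ii) in natural numbers, with [r = k.+1] and denominators cleared. *)
Definition loss_condition p q := q = 0 \/ exists2 k, rr p = k.+1 &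
  2 ^ k + 2 * q <= p - 1 \/
  8 * (q * Nr k.+1) <= 2 ^ k.+1 /\ 2 * q <= k.+1./2.+1 * (p - 1 - 2 ^ k).

Lemma forb_formula p q m : 2 <= p -> q <= p - 1 -> 2 * Nr (rr p) + 2 <= m -> loss_condition p q ->
  forb m 3 (Fabcd (p - q) p p (p - q)) + q * Nr (rr p) = base m + (p - 1) * npairs m.
Proof.
move=> p2 qp hm hc; have p0 : 0 < p by lia.
have pr : p - 1 <= 2 ^ rr p by rewrite up_logP.
apply/eqP; rewrite eqn_leq; apply/andP; split.
  suff main (X : simple_matrix m 3) : ~~ configb (Fabcd (p - q) p p (p - q)) X ->
      #|X| + q * Nr (rr p) <= base m + (p - 1) * npairs m.
    (* The bound for the empty matrix shows that subtracting [q * Nr (rr p)] does not truncate. *)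
    have le_qN : q * Nr (rr p) <= base m + (p - 1) * npairs m.
      have := main set0; rewrite cards0; apply; apply/(avoidP _ p0 qp) => i j _.
      by exists true, true; rewrite (_ : pats _ _ _ _ _ = set0) ?cards0 //; apply/setP => x; rewrite !inE.
    rewrite addnC -leq_subRL //; apply/bigmax_leqP => X /main.
    by rewrite leq_subRL // addnC.
  move=> /(avoidP _ p0 qp) /choose_pattern[a ha].
  case: hc => [->|[k rk hk]]; first by rewrite mul0n addn0; apply: weak_upper ha.
  have hN : q * Nr (rr p) <= 2 ^ (m - 3).
    apply: (@leq_trans (2 ^ (2 * Nr (rr p) - 1))); last by rewrite leq_exp2l //; lia.
    apply: leq_trans (pow_Nr _); last by rewrite rk.
    by rewrite leq_mul2r (leq_trans qp pr) orbT.
  have [/forallP htl|ntl] := boolP [forall e, forall f, forall g,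
      [&& e != f, e != g & f != g] ==> ~~ conflict a e f g]; last first.
    apply: (conflict_upper ha qp hN) => tl; case/negP: ntl.
    apply/forallP => e; apply/forallP => f; apply/forallP => g.
    by apply/implyP => /and3P[ef eg fg]; apply: tl.
  have tl : treelike a.
    move=> e f g ef eg fg; have /forallP/(_ f)/forallP/(_ g) := htl e.
    by rewrite ef eg fg.
  have hge := Nr_ge (rr p).
  have mE : m = (m - k.+2) + k.+2 by rewrite rk in hm hge; lia.
  have ltm : 2 * Nr k.+1 < m by rewrite -rk; lia.
  rewrite rk; case: hk => [hk|[h1 h2]]; first exact: (bad_upper ha qp tl mE).
  apply: (far_upper ha qp tl mE) => //.
  (* [rr p = k.+1] is the least exponent whose power of 2 reaches [p - 1]. *)
  have : ~~ (p - 1 <= 2 ^ k); last by lia.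
  apply/negP => h; have := @up_log_min 2 (p - 1) k isT h; rewrite -/(rr p) rk; lia.
(* These broom sizes give [N_r] incomparable pairs and [2 ^ (U + V - 2) = 2 ^ r], which covers every
   budget. *)
pose U := (uphalf (rr p)).+1; pose V := (rr p)./2.+1.
have hr := odd_double_half (rr p); have hu := uphalf_half (rr p).
have UV : U + V = (rr p).+2 by rewrite /U /V; lia.
have UVm : U + V <= m by have := Nr_ge (rr p); case: (rr p) UV hm => [|r]; lia.
have hp : p - 1 <= 2 ^ (U + V - 2) by rewrite UV subSS subSS subn0.
have [X [/(avoidP _ p0 qp) hX cX]] := lower_bound UVm hp qp.
apply: leq_trans cX _; rewrite {1}/Nr !addn1 leq_add2r.
exact: (@leq_bigmax_cond _ _ (fun X : simple_matrix m 3 => #|X|) X hX).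
Qed.

(** * The theorem *)

Import Order.TTheory GRing.Theory Num.Theory.
Local Open Scope ring_scope.

(** The powers are rational because [r - 1] and [r - 3] may be negative; for positive [r], factors 8
    and 2 make everything integral. *)
Lemma loss_condition_rat (p q : nat) (r := rr p) : (2 <= p)%N ->
    ((2%:Q ^ (r%:Z - 1) + 2 * q%:Q + 1 <= p%:Q)
     \/ [/\ p%:Q <= 2%:Q ^ (r%:Z - 1) + 2 * q%:Q,
            (q * Nr r)%N%:Q <= 2%:Q ^ (r%:Z - 3)
          & q%:Q <= 2^-1 * (r./2 + 1)%N%:Q * (p%:Q - 1 - 2%:Q ^ (r%:Z - 1))]) ->
  loss_condition p q.
Proof.
move=> p2 hc.
have pr : (p - 1 <= 2 ^ rr p)%N by rewrite up_logP.
(* For [rr p = 0] we have [p = 2], and either condition forces [q = 0]. *)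
case er: (rr p) => [|k].
  left; move: hc pr; rewrite /r er => hc pr.
  have pE : p = 2 by rewrite expn0 in pr; lia.
  have [->//|q0] := posnP q.
  have q1 : 1 <= q%:Q by rewrite (ler_int _ 1); lia.
  have e : 2%:Q ^ (0%:Z - 1) = 1 / 2 by [].
  have e1 : (0./2 + 1)%N%:Q = 1 by [].
  by case: hc => [|[_ _]]; rewrite e pE ?e1 (_ : 2%N%:Q = 2) //; move: q%:Q q1 => x; clear=> *; exfalso; lra.
right; exists k => //.
have e1 : 2%:Q ^ (r%:Z - 1) = (2 ^ k)%N%:Q.
  by rewrite /r er (_ : k.+1%:Z - 1 = k%:Z); [rewrite -exprnP -natrX|lia].
have e3 : 8 * 2%:Q ^ (r%:Z - 3) = (2 ^ k.+1)%N%:Q.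
  rewrite /r er expfzDr // mulrC -mulrA (_ : _ * 8 = 1) // mulr1.
  by rewrite -exprnP -natrX.
case: hc => [h|[_ h1 h2]]; [left|right].
  move: h; rewrite e1 -[1 in X in X -> _]/(1%:~R) -[2 in X in X -> _]/(2%:~R).
  by rewrite -!(intrM, intrD) ler_int; lia.
split.
  have : (8 * (q * Nr k.+1))%N%:Q <= (2 ^ k.+1)%N%:Q.
    by rewrite -e3 PoszM intrM; move: h1; rewrite /r er; lra.
  by rewrite ler_int; lia.
have h3 : 2 * q%:Q <= (k.+1./2 + 1)%N%:Q * (p%:Q - 1 - (2 ^ k)%N%:Q).
  by move: h2; rewrite e1 /r er; lra.
move: h3; rewrite -[1 in X in X -> _]/(1%:~R) -[2 in X in X -> _]/(2%:~R).
rewrite -!(intrM, intrD, intrN, intrB) ler_int addn1.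
have [le|lt] := leqP (2 ^ k) (p - 1).
  have -> : p%:Z - 1 - (2 ^ k)%N%:Z = (p - 1 - 2 ^ k)%N%:Z by lia.
  by rewrite -!PoszM lez_nat.
have := @up_log_min 2 (p - 1) k isT (ltnW lt); rewrite -/(rr p) er; lia.
Qed.

Lemma cube_le_exp n : (10 <= n)%N -> (n * n * n <= 2 ^ n)%N.
Proof.
elim: n => // n IH; rewrite leq_eqVlt => /orP[/eqP <-//|hn].
by rewrite expnS; have := IH hn; nia.
Qed.

Lemma Nr_le r : (Nr r <= r * r)%N.
Proof. by elim: r => // r IH; rewrite NrS /=; have := odd_double_half r; nia. Qed.

(** Here [r > 16 q + 10]. If (i) fails, (ii) holds: [8 q N_r <= 8 q r^2 <= r^3 <= 2^r], and
    [r./2 + 1 >= 2 q] while [p - 1 - 2 ^ (r - 1)] is positive. *)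
Lemma loss_condition_large (p q : nat) : (2 ^ (16 * q + 10) + 2 <= p)%N -> loss_condition p q.
Proof.
move=> hp; have pr : (p - 1 <= 2 ^ rr p)%N by rewrite up_logP.
have hr : (16 * q + 10 < rr p)%N.
  by rewrite -(@ltn_exp2l 2) //; apply: leq_trans pr; lia.
right; exists (rr p).-1; first by lia.
have -> : (rr p).-1.+1 = rr p by lia.
have [h|h] := leqP (2 ^ (rr p).-1 + 2 * q) (p - 1); first by left.
right; split.
  have := @cube_le_exp (rr p) _; have := Nr_le (rr p).
  by move: (rr p) (Nr _) hr => r N hr hN /(_ _) h3; apply: leq_trans (h3 _); nia.
have hD : (0 < p - 1 - 2 ^ (rr p).-1)%N.
  rewrite subn_gt0 ltnNge; apply/negP => h'.
  have := @up_log_min 2 (p - 1) (rr p).-1 isT h'; rewrite -/(rr p); lia.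
have := odd_double_half (rr p); nia.
Qed.

(** Compare [forb_formula] for [q] with its instance for 0. *)
Lemma forb_difference (p q m : nat) : (2 <= p)%N -> (q <= p - 1)%N ->
    (2 * Nr (rr p) + 2 <= m)%N -> loss_condition p q ->
  (forb m 3 (Fabcd (p - q) p p (p - q)))%:Z = (forb m 3 (pK2 p))%:Z - (q * Nr (rr p))%N%:Z.
Proof.
move=> p2 qp hm hc; have := forb_formula p2 qp hm hc.
have := @forb_formula p 0 m p2 (leq0n _) hm (or_introl (erefl _)).
rewrite subn0 mul0n addn0 -forb_pK2 => -> <-; by rewrite PoszD addrK.
Qed.

Theorem mainTheorem3 :
  (forall p q m : nat,
    (2 <= p)%N -> (q <= p - 1)%N -> (2 * Nr (rr p) + 2 <= m)%N ->
    let r := rr p in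
    ((2%:Q ^ (r%:Z - 1) + 2 * q%:Q + 1 <= p%:Q)
     \/ [/\ p%:Q <= 2%:Q ^ (r%:Z - 1) + 2 * q%:Q,
            (q * Nr r)%N%:Q <= 2%:Q ^ (r%:Z - 3)
          & q%:Q <= 2^-1 * (r./2 + 1)%N%:Q * (p%:Q - 1 - 2%:Q ^ (r%:Z - 1))]) ->
    (forb m 3 (Fabcd (p - q) p p (p - q)))%:Z
      = (forb m 3 (pK2 p))%:Z - (q * Nr r)%N%:Z)
  /\
  (forall q : nat, exists P : nat, forall p m : nat,
    (P <= p)%N -> (2 * Nr (rr p) + 2 <= m)%N ->
    (forb m 3 (Fabcd (p - q) p p (p - q)))%:Z
      = (forb m 3 (pK2 p))%:Z - (q * Nr (rr p))%N%:Z).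
Proof.
split=> [p q m p2 qp hm r hc|q].
  by apply: forb_difference => //; apply: loss_condition_rat.
exists (2 ^ (16 * q + 10) + 2)%N => p m hp hm.
have hq : (q < 2 ^ (16 * q + 10))%N by apply: leq_ltn_trans (ltn_expl _ (isT : (1 < 2)%N)); lia.
by apply: forb_difference => //; [lia|lia|apply: loss_condition_large].
Qed.
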